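(* Let $\Bbbk$ be a field and $n\ge 1$ an integer. (a) If $\operatorname{char}(\Bbbk)\neq 2$, then the module of relations of $\det_n^{\perp}$ is minimally generated by $4\binom{n+1}{3}\binom{n+2}{3}$ linear relations. (b) In arbitrary characteristic, the module of relations of $\operatorname{perm}_n^{\perp}$ is minimally generated by $4\binom{n+1}{3}\binom{n+2}{3}$ linear relations and $2\binom{n}{2}\binom{n}{4}$ quadratic relations.
   Context: Let $R=\Bbbk[x_{i,j}]$ and $S=\Bbbk[X_{i,j}]$, $1\le i,j\le n$, with the standard grading $\deg X_{i,j}=1$. $S$ acts on $R$ as follows: identify $X_{i,j}$ with $x_{i,j}^{-1}$; for monomials $g\in S$, $f\in R$, $g\star f=gf$ if the product in the fraction field of $R$ lies in $R$, and $g\star f=0$ otherwise; extend bilinearly. (On $\det_n$ and $\operatorname{perm}_n$, $X_{i,j}$ acts as $\partial/\partial x_{i,j}$.) Here $\det_n,\operatorname{perm}_n\in R$ are the determinant and permanent of the generic matrix $(x_{i,j})$. The apolar ideal of $f\in R$ is $f^\perp=\{g\in S: g\star f=0\}$. Both $I=\det_n^\perp$ and $I=\operatorname{perm}_n^\perp$ are minimally generated by $\binom{n+1}{2}^2$ quadrics: $X_{i,j}^2$; $X_{i,j}X_{i,k}$ ($j\ne k$); $X_{i,j}X_{k,j}$ ($i\neq k$); and, for $i\ne k$, $j\neq l$, $X_{i,j}X_{k,l}+X_{i,l}X_{k,j}$ (for $\det_n$), respectively $X_{i,j}X_{k,l}-X_{i,l}X_{k,j}$ (for $\operatorname{perm}_n$,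 up to sign). Let $F_1$ be the free $S$-module with basis symbols $(g)$, one for each of these minimal quadratic generators $g$, with $(g)$ in degree $2$, and let $d_1:F_1\to S$ be given by $d_1((g))=g$. A relation of $I$ is an element of $\ker d_1$. A homogeneous relation is called linear if its coefficients in $S$ have degree $1$ (so it has degree $3$ in $F_1$) and quadratic if they have degree $2$ (degree $4$ in $F_1$). ''Minimally generated'' refers to a minimal homogeneous generating set of the graded $S$-module $\ker d_1$. Binomial coefficients $\binom{a}{b}$ with $0\le a<b$ are $0$. *)

(* Defs.v *)
From HB Require Import structures.
From mathcomp Require Import all_boot all_order all_fingroup all_algebra.
From mathcomp Require Import mpoly.

Set Implicit Arguments.
Unset Strict Implicit.
Unset Printing Implicit Defensive.

Import GRing.Theory.
Local Open Scope ring_scope.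

(* [A] indexes a subfamily of [r]; indexing by a finite type rather than using
   a set of vectors makes repetitions count, and minimality excludes them. *)
Definition generates (S : nzRingType) (V : lmodType S) (I : finType)
    (r : I -> V) (A : {set I}) (M : V -> Prop) : Prop :=
  (forall i, i \in A -> M (r i)) /\
  (forall v, M v -> exists c : I -> S, v = \sum_(i in A) c i *: r i).

Definition minimally_generates (S : nzRingType) (V : lmodType S) (I : finType)
    (r : I -> V) (M : V -> Prop) : Prop :=
  generates r [set: I] M /\
  (forall A : {set I}, A \proper [set: I] -> ~ generates r A M).

(* R = k[x_ij] and S = k[X_ij] are both represented by {mpoly k[n * n]}; they
   are distinguished by their roles in the action [contract] (S acts on R). *)
Definition mxvar (k : fieldType) (n : nat) (i j : 'I_n) : {mpoly k[n * n]} :=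
  'X_(mxvec_index i j).

Definition generic_mx (k : fieldType) (n : nat) : 'M[{mpoly k[n * n]}]_n :=
  \matrix_(i, j) mxvar k i j.

Definition det_poly (k : fieldType) (n : nat) : {mpoly k[n * n]} :=
  \det (generic_mx k n).

Definition perm_poly (k : fieldType) (n : nat) : {mpoly k[n * n]} :=
  \sum_(s : 'S_n) \prod_i generic_mx k n i (s i).

(* The bilinear extension of: X^m * x^m' = x^(m' - m) if m <= m' componentwise,
   and 0 otherwise. *)
Definition contract (k : fieldType) (n : nat) (g f : {mpoly k[n * n]}) :
    {mpoly k[n * n]} :=
  \sum_(m <- msupp g) \sum_(m' <- msupp f | (m <= m')%MM)
    (g@_m * f@_m') *: 'X_[m' - m].

Definition apolar (k : fieldType) (n : nat) (f : {mpoly k[n * n]}) :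
    {mpoly k[n * n]}^o -> Prop :=
  fun g => contract g f = 0.

Definition le_pair (n : nat) := {p : 'I_n * 'I_n | (p.1 <= p.2)%N}.

(* A pair of row indices i <= k together with a pair of column indices j <= l;
   there are binomial(n + 1, 2)^2 of these, one for each quadric. *)
Definition quad_index (n : nat) : finType := (le_pair n * le_pair n)%type.

(* If i = k or j = l this is the monomial X_ij X_kl, that is X_ij^2,
   X_ij X_il or X_ij X_kj; each unordered pair of variables occurs once. *)
Definition quadric (k : fieldType) (n : nat) (e : k) (q : quad_index n) :
    {mpoly k[n * n]}^o :=
  let: (i, i') := val q.1 in
  let: (j, j') := val q.2 in
  if (i == i') || (j == j') then mxvar k i j * mxvar k i' j'
  else mxvar k i j * mxvar k i' j' + e *: (mxvar k i j' * mxvar k i' j).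

Definition det_quadric (k : fieldType) (n : nat) := @quadric k n 1.

Definition perm_quadric (k : fieldType) (n : nat) := @quadric k n (- 1).

(* The basis symbol (g_q) corresponds to the indicator function of q. *)
Definition F1 (k : fieldType) (n : nat) : lmodType {mpoly k[n * n]} :=
  {ffun quad_index n -> {mpoly k[n * n]}^o}.

Definition d1 (k : fieldType) (n : nat)
    (g : quad_index n -> {mpoly k[n * n]}^o) (u : F1 k n) :
    {mpoly k[n * n]}^o :=
  \sum_q (u : {ffun _ -> _}) q *: g q.

Definition relation (k : fieldType) (n : nat)
    (g : quad_index n -> {mpoly k[n * n]}^o) (u : F1 k n) : Prop :=
  d1 g u = 0.

(* Every coefficient of [u] is homogeneous of degree [d], so that [u] is
   homogeneous of degree [d + 2] in F_1. *)
Definition coefs_homog (k : fieldType) (n d : nat) (u : F1 k n) : Prop :=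
  forall q, ((u : {ffun quad_index n -> _}) q : {mpoly k[n * n]}) \is d.-homog.

Definition linear_relation (k : fieldType) (n : nat)
    (g : quad_index n -> {mpoly k[n * n]}^o) (u : F1 k n) : Prop :=
  relation g u /\ coefs_homog 1 u.

Definition quadratic_relation (k : fieldType) (n : nat)
    (g : quad_index n -> {mpoly k[n * n]}^o) (u : F1 k n) : Prop :=
  relation g u /\ coefs_homog 2 u.

(* Main.v *)
(** Grade S by row and column degrees. A monomial is square-free if it uses each
    row and column at most once; square-free monomials of the same multidegree are
    congruent up to sign modulo the ideal I of quadrics, and all others lie in I.

    To generate the relations, one chooses a splitting of d1: sigma M is an element
    of F_1 above each monomial M, up to a fixed monomial of its multidegree, such
    that X^m (g) = sigma(M) + e sigma(M') modulo the submodule N generated by the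
    linear relations, whenever X^m g = M + e M'. Then d1 u = 0 forces u to be in N.
    Such a sigma exists as soon as the Koszul relations between two quadrics
    are in N. The only ones that might not be are
    X_kc X_kd (X_ia X_ib) - X_ia X_ib (X_kc X_kd) with a, b, c, d distinct, and their
    transposes. Modulo N, exchanging b and c multiplies this defect by -e. For the
    determinant (e = 1) an odd number of exchanges returns to the start, so 2 times
    the defect is in N; for the permanent (e = -1) one defect remains for each
    choice of two lines and four transversal ones.

    The linear relations are counted by rank-nullity in degree 3, and the defects
    are seen not to be redundant by a functional that sums, over one of the two
    lines, the coefficients in the multidegree of the defect. *)

From HB Require Import structures.
Require Import Defs.
From mathcomp Require Import all_boot all_order all_fingroup all_algebra.
From mathcomp Require Import mpoly ssrcomplements ring zify.

Set Implicit Arguments.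
Unset Strict Implicit.
Unset Printing Implicit Defensive.

Import GRing.Theory.
Local Open Scope ring_scope.

(** * Koszul relations modulo the linear relations *)

Section Koszul.

Variables (S : comNzRingType) (Q : finType).
Local Notation F := {ffun Q -> S^o}.

(** In a square-free multidegree the monomials are the bijections between the rows and the columns
    involved, and each two-term quadric joins monomials that differ by a transposition. A splitting
    requires every closed walk in this graph to give an element of N. Two kinds of pieces fill these
    walks: four-cycles inside a three-by-three block, which are linear relations ([rel_cycle_row],
    [rel_cycle_col]), and squares made of two disjoint transpositions, which are Koszul relations
    and decompose into five such four-cycles ([edge_edge]). Rather than treating closed walks,
    [chain] fixes one route from each monomial to a common end, and induction on the degree shows
    that every edge agrees with the routes of its two ends. In the other multidegrees every monomial
    is divisible by a monomial quadric, and only the independence of the lift from the choice of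
    this quadric is at stake; this is where the defects occur. N stays abstract because it is used
    twice: for the determinant as the span of the linear relations, for the permanent as a span that
    also contains the quadratic ones. *)

Record submodule (N : F -> Prop) : Prop := Submodule {
  sub0 : N 0;
  subD : forall u v, N u -> N v -> N (u + v);
  subZ : forall p u, N u -> N (p *: u) }.

Definition modulo (N : F -> Prop) (u v : F) := N (u - v).

(* The linear relations between the symbols, over arbitrary index types so that
   rows and columns can be exchanged; e = 1 for det_n and e = -1 for perm_n. *)
Record basic_relations (e : S) (N : F -> Prop) (I J : eqType)
    (x : I -> J -> S) (E : I -> J -> I -> J -> F) : Prop := BasicRelations {
  relC : forall i j k l, E i j k l = E k l i j;
  rel_swap : forall i j k l, i != k -> j != l -> E i l k j = e *: E i j k l;
  rel_row : forall i a b c,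
    modulo N (x i c *: E i a i b) (x i b *: E i a i c);
  rel_col : forall a i j k,
    modulo N (x k a *: E i a j a) (x j a *: E i a k a);
  rel_corner : forall i a b k,
    modulo N (x k a *: E i a i b) (x i b *: E i a k a);
  rel_edge_row : forall i k a b c, i != k -> a != b ->
    modulo N (x i c *: E i a k b)
             (x k b *: E i c i a + (e * x k a) *: E i c i b);
  rel_edge_col : forall i k a b h, i != k -> a != b ->
    modulo N (x h a *: E i a k b)
             (x k b *: E h a i a + (e * x i b) *: E h a k a);
  rel_cycle_row : forall i r s c j u,
    i != r -> i != s -> r != s -> c != j -> c != u -> j != u ->
    modulo N (x r j *: E i c s u + (e * x i j) *: E r c s u)
             (x s u *: E i c r j + (e * x s c) *: E i u r j);
  rel_cycle_col : forall i r s c j u,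
    i != r -> i != s -> r != s -> c != j -> c != u -> j != u ->
    modulo N (x r j *: E i c s u + (e * x r c) *: E i j s u)
             (x s u *: E i c r j + (e * x i u) *: E s c r j) }.

(** The Koszul relations that [basic_relations] does not give in general, isolated as a hypothesis:
    [four_relations_half] proves them when [e] = 1 and 2 is invertible, and for the permanent the
    added quadratic relations supply them. *)
Definition four_relations (N : F -> Prop) (I J : eqType)
    (x : I -> J -> S) (E : I -> J -> I -> J -> F) : Prop :=
  forall i k a b c d, i != k -> uniq [:: a; b; c; d] ->
    modulo N ((x k c * x k d) *: E i a i b) ((x i a * x i b) *: E k c k d).

Lemma moduloC N u v : submodule N -> modulo N u v -> modulo N v u.
Proof. by move=> HN /(subZ HN (-1)); rewrite scaleN1r opprB. Qed.

Lemma basic_relationsT e N (I J : eqType) x E : submodule N ->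
  basic_relations e N (I := I) (J := J) x E ->
  basic_relations e N (fun j i => x i j) (fun j i l k => E i j k l).
Proof.
move=> HN [H1 H2 H3 H4 H5 H6 H7 H8 H9]; split=> /=.
- by move=> i j k l; apply: H1.
- by move=> i j k l nik njl; rewrite H1; apply: H2.
- by move=> i a b c; apply: H4.
- by move=> a i j k; apply: H3.
- by move=> i a b k; apply: moduloC.
- by move=> i k a b c *; apply: H7.
- by move=> i k a b h *; apply: H6.
- by move=> *; apply: H9.
- by move=> *; apply: H8.
Qed.

Section Derived.

Variables (e : S) (N : F -> Prop) (HN : submodule N) (ee : e * e = 1).
Variables (I J : eqType) (x : I -> J -> S) (E : I -> J -> I -> J -> F).
Hypothesis (HE : basic_relations e N x E).

(** Each derivation below writes an element as an explicit combination of known elements of N;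
    [coords] then checks the identity coordinatewise by [ring] modulo [ee], with the coordinates of
    the symbols as atoms. *)
Lemma lincomb2 p1 p2 u1 u2 w : N u1 -> N u2 -> w = p1 *: u1 + p2 *: u2 -> N w.
Proof. by move=> ? ? ->; apply: subD => //; apply: subZ. Qed.

Lemma lincomb3 p1 p2 p3 u1 u2 u3 w : N u1 -> N u2 -> N u3 ->
  w = p1 *: u1 + p2 *: u2 + p3 *: u3 -> N w.
Proof. by move=> ? ? ? ->; do 2?apply: subD => //; apply: subZ. Qed.

Lemma lincomb4 p1 p2 p3 p4 u1 u2 u3 u4 w : N u1 -> N u2 -> N u3 -> N u4 ->
  w = p1 *: u1 + p2 *: u2 + p3 *: u3 + p4 *: u4 -> N w.
Proof. by move=> ? ? ? ? ->; do 3?apply: subD => //; apply: subZ. Qed.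

Lemma lincomb5 p1 p2 p3 p4 p5 u1 u2 u3 u4 u5 w :
  N u1 -> N u2 -> N u3 -> N u4 -> N u5 ->
  w = p1 *: u1 + p2 *: u2 + p3 *: u3 + p4 *: u4 + p5 *: u5 -> N w.
Proof. by move=> ? ? ? ? ? ->; do 4?apply: subD => //; apply: subZ. Qed.

Ltac coords :=
  apply/ffunP=> ?; rewrite !ffunE /GRing.scale /=;
  repeat match goal with
  | |- context [E ?i ?j ?k ?l] => move: (E i j k l) => ?
  | |- context [x ?i ?j] => move: (x i j) => ?
  end; ring: ee.

Lemma row_row_same i a b c d :
  modulo N ((x i c * x i d) *: E i a i b) ((x i a * x i b) *: E i c i d).
Proof.
apply: (lincomb2 (p1 := x i d) (p2 := x i b)
  (rel_row HE i a b c) (rel_row HE i c a d)).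
rewrite (relC HE i c i a); coords.
Qed.

(** In general position the edge through X_id and X_ja meets both lines: its multiple by X_ib X_ka
    expands along row i and along column a, and comparing the two expansions gives the claim up to
    corner relations. *)
Lemma row_col i b d a j k :
  modulo N ((x j a * x k a) *: E i b i d) ((x i b * x i d) *: E j a k a).
Proof.
have eq_row j' k' b' d' : modulo N ((x j' a * x k' a) *: E j' b' j' d')
    ((x j' b' * x j' d') *: E j' a k' a).
  apply: (lincomb2 (p1 := x k' a) (p2 := x j' d')
    (rel_row HE j' b' d' a) (rel_corner HE j' a b' k')).
  rewrite (relC HE j' b' j' a); coords.
have eq_col j' k' d' : modulo N ((x j' a * x k' a) *: E i a i d')
    ((x i a * x i d') *: E j' a k' a).
  apply: (lincomb2 (p1 := x k' a) (p2 := x i d')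
    (rel_corner HE i a d' j') (rel_col HE a j' i k')).
  rewrite (relC HE j' a i a); coords.
have [->|nij] := eqVneq i j; first exact: eq_row.
have [->|nik] := eqVneq i k; first by rewrite mulrC (relC HE j); apply: eq_row.
have [->|nba] := eqVneq b a; first exact: eq_col.
have [->|nda] := eqVneq d a.
  by rewrite (relC HE i b) [x i b * _]mulrC; apply: eq_col.
apply: (lincomb3 (p1 := - x k a) (p2 := x i b) (p3 := - (e * x j d))
  (rel_edge_row HE b nij nda) (rel_edge_col (i := j) (k := i) (a := a) (b := d) HE k _ _)
  (rel_corner HE i a b k)); rewrite 1?eq_sym //.
rewrite (relC HE j a i d) (relC HE k a j a) (relC HE k a i a) (relC HE i b i a).
coords.
Qed.

Definition row_defect i k a b c d :=
  (x k c * x k d) *: E i a i b - (x i a * x i b) *: E k c k d.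

(** The multiple by X_ia X_kd of the edge X_ib X_kc + e X_ic X_kb expands along row i and along row
    k. The difference of the two expansions is the defect plus [e] times the exchanged defect. *)
Lemma row_defect_step i k a b c d : i != k -> b != c ->
  modulo N (row_defect i k a b c d) (- e *: row_defect i k a c b d).
Proof.
move=> nik nbc; rewrite eq_sym in nik; move: (nik); rewrite eq_sym => nki.
apply: (lincomb2 (p1 := - x k d) (p2 := x i a)
  (rel_edge_row HE a nki nbc) (rel_edge_row (a := c) (b := b) HE d nik _)).
  by rewrite eq_sym.
rewrite /row_defect (relC HE k c i b) (relC HE k d k c) (relC HE k d k b).
coords.
Qed.

Lemma row_defect_share i k a b d : N (row_defect i k a b a d).
Proof.
apply: (lincomb2 (p1 := x k d) (p2 := - x i b)
  (rel_corner HE i a b k) (rel_corner HE k a d i)).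
rewrite /row_defect (relC HE k a i a); coords.
Qed.

Lemma row_row (four : four_relations N x E) i k a b c d :
  modulo N ((x k c * x k d) *: E i a i b) ((x i a * x i b) *: E k c k d).
Proof.
have [<-|nik] := eqVneq i k; first exact: row_row_same.
rewrite /modulo -/(row_defect i k a b c d).
have C1 a' b' c' d' : row_defect i k a' b' c' d' = row_defect i k b' a' c' d'.
  by rewrite /row_defect (relC HE i b') [x i b' * _]mulrC.
have C2 a' b' c' d' : row_defect i k a' b' c' d' = row_defect i k a' b' d' c'.
  by rewrite /row_defect (relC HE k d') [x k d' * _]mulrC.
have step a' b' c' d' : b' != c' -> N (row_defect i k a' c' b' d') ->
    N (row_defect i k a' b' c' d').
  move=> nbc h; apply: (lincomb2 (p1 := 1) (p2 := - e)
    (row_defect_step a' d' nik nbc) h); coords.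
have [<-|nac] := eqVneq a c; first exact: row_defect_share.
have [<-|nad] := eqVneq a d; first by rewrite C2; apply: row_defect_share.
have [<-|nbc] := eqVneq b c; first by rewrite C1; apply: row_defect_share.
have [<-|nbd] := eqVneq b d; first by rewrite C1 C2; apply: row_defect_share.
(* Equal columns within one pair are separated by one exchange, after which the two pairs share a
   column. *)
have [ab|nab] := eqVneq a b.
  by rewrite -ab; apply: step => //; apply: row_defect_share.
have [cd|ncd] := eqVneq c d.
  by rewrite -cd; apply: step => //; rewrite C1 C2; apply: row_defect_share.
by apply: four => //=; rewrite !inE !negb_or nab nac nad nbc nbd ncd.
Qed.

Lemma row_edge i c d j a k b : j != k -> a != b ->
  modulo N ((x i c * x i d) *: E j a k b)
           ((x j a * x k b + e * x j b * x k a) *: E i c i d).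
Proof.
move=> njk nab; have nkj : k != j by rewrite eq_sym.
have nba : b != a by rewrite eq_sym.
have eq_row j' k' a' b' : j' != k' -> a' != b' ->
    modulo N ((x j' c * x j' d) *: E j' a' k' b')
      ((x j' a' * x k' b' + e * x j' b' * x k' a') *: E j' c j' d).
  move=> nj na; apply: (lincomb3 (p1 := x j' d) (p2 := x k' b')
    (p3 := e * x k' a') (rel_edge_row HE c nj na) (rel_row HE j' c a' d)
    (rel_row HE j' c b' d)); coords.
have [->|nij] := eqVneq i j; first exact: eq_row.
have [->|nik] := eqVneq i k.
  by rewrite (relC HE j) mulrC [x j a * _]mulrC -mulrA [x j b * _]mulrC mulrA
    [x k d * _]mulrC; apply: eq_row.
have eq_col j' k' a' b' : j' != k' -> a' != b' ->
    modulo N ((x i a' * x i d) *: E j' a' k' b')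
      ((x j' a' * x k' b' + e * x j' b' * x k' a') *: E i a' i d).
  move=> nj na; apply: (lincomb3 (p1 := x i d) (p2 := - x k' b')
    (p3 := - (e * x j' b')) (rel_edge_col HE i nj na)
    (rel_corner HE i a' d j') (rel_corner HE i a' d k')); coords.
have [->|nca] := eqVneq c a; first exact: eq_col.
have [->|ncb] := eqVneq c b.
  by rewrite (relC HE j) [x j a * _]mulrC -mulrA [x j b * _]mulrC mulrA;
    apply: eq_col.
have nac : a != c by rewrite eq_sym.
have nbc : b != c by rewrite eq_sym.
(* The cycle on rows i, j, k and columns a, c, b, multiplied by X_id, trades the edge between rows j
   and k for edges that involve row i; these expand along the line by [rel_edge_row]. *)
apply: (lincomb4 (p1 := e * x i d) (p2 := - (e * x j c)) (p3 := e * x k b)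
  (p4 := x k a) (rel_cycle_row HE nij nik njk nac nab ncb)
  (rel_edge_row HE d nik nab) (rel_edge_row HE d nij nac)
  (rel_edge_row HE d nij nbc)).
rewrite (relC HE i c i d); coords.
Qed.

(** The Koszul relation of two disjoint edges is a sum of five cycles, each in a three-by-three
    block of the four rows and four columns and multiplied by the variable in the remaining row and
    column. *)
Lemma edge_edge i r s t c j u v :
  uniq [:: i; r; s; t] -> uniq [:: c; j; u; v] ->
  modulo N ((x i c * x r j + e * x i j * x r c) *: E s u t v)
           ((x s u * x t v + e * x s v * x t u) *: E i c r j).
Proof.
rewrite /= !inE !negb_or !andbT.
move=> /and3P[/and3P[nir nis nit] /andP[nrs nrt] nst].
move=> /and3P[/and3P[ncj ncu ncv] /andP[nju njv] nuv].
have sym (T : eqType) (y z : T) : y != z -> z != y by rewrite eq_sym.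
apply: (lincomb5 (p1 := e * x r j) (p2 := x i j) (p3 := e * x t v)
  (p4 := - (e * x s c)) (p5 := x t u)
  (rel_cycle_row (i := i) (r := s) (s := t) (c := u) (j := c) (u := v) HE
    _ _ _ _ _ _)
  (rel_cycle_row (i := r) (r := s) (s := t) (c := u) (j := c) (u := v) HE
    _ _ _ _ _ _)
  (rel_cycle_row (i := i) (r := r) (s := s) (c := u) (j := j) (u := c) HE
    _ _ _ _ _ _)
  (rel_cycle_row (i := i) (r := r) (s := t) (c := u) (j := j) (u := v) HE
    _ _ _ _ _ _)
  (rel_cycle_row (i := i) (r := r) (s := s) (c := v) (j := j) (u := c) HE
    _ _ _ _ _ _)); do ?[by [|apply: sym]].
coords.
Qed.

Lemma four_relations_half (h : S) : e = 1 -> 2 * h = 1 -> four_relations N x E.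
Proof.
(* Three exchanges restore the defect and, as e = 1, reverse its sign. *)
move=> e1 hh i k a b c d nik.
rewrite /= !inE !negb_or => /and4P[/and3P[nab nac _] /andP[nbc _] _ _].
rewrite eq_sym in nac.
rewrite /modulo -/(row_defect i k a b c d).
have -> : row_defect i k a b c d = h *: (2 *: row_defect i k a b c d).
  by rewrite scalerA mulrC hh scale1r.
apply: subZ => //.
apply: (lincomb3 (p1 := 1) (p2 := - 1) (p3 := 1) (row_defect_step a d nik nbc)
  (row_defect_step c d nik nab) (row_defect_step b d nik nac)).
rewrite /row_defect e1 (relC HE i b i a) (relC HE i c i a) (relC HE i b i c).
coords.
Qed.

End Derived.

Section Sorted.

Variables (N : F -> Prop) (HN : submodule N) (m n : nat).
Variables (x : 'I_m -> 'I_n -> S) (E : 'I_m -> 'I_n -> 'I_m -> 'I_n -> F).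
Hypothesis (HE : basic_relations (- 1) N x E).

(** For [e] = -1 an exchange preserves the defect modulo N, so the defect depends only on the set of
    four columns and, up to sign, on the set of two rows. Sorted indices therefore suffice. *)
Lemma four_relations_sorted :
  (forall (i k : 'I_m) (a b c d : 'I_n), (i < k)%N -> (a < b)%N -> (b < c)%N -> (c < d)%N ->
     N (row_defect x E i k a b c d)) ->
  four_relations N x E.
Proof.
move=> sorted i k a b c d nik nabcd; rewrite /modulo -/(row_defect x E i k a b c d).
wlog ltik : i k a b c d nik nabcd / (i < k)%N => [hwlog|].
  case: (ltngtP i k) => [|ltki|/val_inj eik]; first exact: hwlog.
    have -> : row_defect x E i k a b c d = - 1 *: row_defect x E k i c d a b.
      by rewrite scaleN1r /row_defect opprB.
    apply: subZ => //; apply: hwlog; rewrite 1?eq_sym //.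
    by rewrite -(rot_uniq 2) in nabcd.
  by rewrite eik eqxx in nik.
have C1 a' b' c' d' : N (row_defect x E i k b' a' c' d') ->
    N (row_defect x E i k a' b' c' d').
  by rewrite /row_defect (relC HE i b') [x i b' * _]mulrC.
have C2 a' b' c' d' : N (row_defect x E i k a' b' d' c') ->
    N (row_defect x E i k a' b' c' d').
  by rewrite /row_defect (relC HE k d') [x k d' * _]mulrC.
have step (a' b' c' d' : 'I_n) : (c' < b')%N -> N (row_defect x E i k a' c' b' d') ->
    N (row_defect x E i k a' b' c' d').
  move=> lt h; have nbc : b' != c' by rewrite -(inj_eq val_inj) gtn_eqF.
  have NN : - 1 * - 1 = 1 :> S by rewrite mulrNN mulr1.
  have := row_defect_step HN NN HE a' d' nik nbc.
  by rewrite opprK scale1r => /(subD HN) /(_ h); rewrite subrK.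
have lt4 (a' b' c' d' : 'I_n) : uniq [:: a'; b'; c'; d'] -> (a' < b')%N -> (c' < d')%N ->
    N (row_defect x E i k a' b' c' d').
  rewrite /= !inE !negb_or => /and4P[/and3P[_ nac nad] /andP[nbc nbd] _ _] ab cd.
  case: (ltngtP b' c') => [bc|cb|/val_inj eq]; first exact: sorted.
    case: (ltngtP a' c') => [ac|ca|/val_inj eq]; last by rewrite eq eqxx in nac.
      apply: step => //.
      case: (ltngtP b' d') => [bd|db|/val_inj eq]; first exact: sorted.
        by apply: C2; apply: sorted.
      by rewrite eq eqxx in nbd.
    apply: (step) => //; apply: C1.
    case: (ltngtP b' d') => [bd|db|/val_inj eq]; first exact: sorted.
      apply: C2; case: (ltngtP a' d') => [ad|da|/val_inj eq].
      - exact: sorted.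
      - by apply: step => //; apply: sorted.
      - by rewrite eq eqxx in nad.
    by rewrite eq eqxx in nbd.
  by rewrite eq eqxx in nbc.
have lt2 (a' b' c' d' : 'I_n) : uniq [:: a'; b'; c'; d'] -> (a' < b')%N ->
    N (row_defect x E i k a' b' c' d').
  move=> u ab; case: (ltngtP c' d') => [cd|dc|/val_inj eq]; first exact: lt4.
    apply: C2; apply: lt4 => //; move: u.
    by rewrite -(perm_uniq (_ : perm_eq [:: a'; b'; d'; c'] _)) //
      !perm_cons (perm_catC [:: d'] [:: c']).
  by move: u; rewrite eq /= !inE eqxx !andbF.
case: (ltngtP a b) => [ab|ba|/val_inj eq]; first exact: lt2.
  apply: C1; apply: lt2 => //; move: nabcd.
  by rewrite /= !inE eq_sym !negb_or => /and4P[/and3P[-> -> ->] /andP[-> ->] -> _].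
by move: nabcd; rewrite eq /= !inE eqxx.
Qed.

End Sorted.

Section Lines.

Variables (e : S) (N : F -> Prop) (HN : submodule N) (ee : e * e = 1).
Variables (I J : eqType) (x : I -> J -> S) (E : I -> J -> I -> J -> F).
Hypothesis (HE : basic_relations e N x E).

Let HET := basic_relationsT HN HE.
Local Notation xc z := (x z.1 z.2).
Local Notation Ec z w := (E z.1 z.2 w.1 w.2).

(** The pairs of cells whose product is itself a quadric, equal cells included; rows and columns are
    treated together from here on. *)
Definition line (z w : I * J) := (z.1 == w.1) || (z.2 == w.2).

Lemma line_share z y w : line z y -> line z w ->
  modulo N (xc w *: Ec z y) (xc y *: Ec z w).
Proof.
case: z y w => [i j] [k l] [p q] /=; rewrite /line /=.
case/orP=> /eqP<- /orP[]/eqP<-.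
- exact: rel_row HE _ _ _ _.
- exact: rel_corner HE _ _ _ _.
- by apply: moduloC => //; apply: rel_corner HE _ _ _ _.
- exact: rel_col HE _ _ _ _.
Qed.

Lemma line_edge z w j a k b : line z w -> j != k -> a != b ->
  modulo N ((xc z * xc w) *: E j a k b)
           ((x j a * x k b + e * x j b * x k a) *: Ec z w).
Proof.
case: z w => [i c] [i' c'] /=; rewrite /line /= => /orP[]/eqP<- njk nab.
  exact: row_edge.
rewrite -mulrA [x j b * _]mulrC mulrA.
exact: (row_edge HN ee HET).
Qed.

Hypothesis (four : four_relations N x E).
Hypothesis (fourT :
  four_relations N (fun j i => x i j) (fun j i l k => E i j k l)).

Lemma line_line z w z' w' : line z w -> line z' w' ->
  modulo N ((xc z' * xc w') *: Ec z w) ((xc z * xc w) *: Ec z' w').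
Proof.
case: z w z' w' => [i j] [k l] [i' j'] [k' l'] /=; rewrite /line /=.
case/orP=> /eqP<- /orP[]/eqP<-.
- exact: (row_row HN ee HE).
- exact: (row_col HN ee HE).
- by apply: moduloC => //; apply: (row_col HN ee HE).
- exact: (row_row HN ee HET fourT).
Qed.

End Lines.
End Koszul.

(** * The symbols of the quadrics *)

Section SortedPairs.

Variable n : nat.

Lemma sort_pair_subproof (i k : 'I_n) :
  let p := if (i <= k)%N then (i, k) else (k, i) in (p.1 <= p.2)%N.
Proof. by case: leqP => //= /ltnW. Qed.

Definition sort_pair (i k : 'I_n) : Defs.le_pair n :=
  Sub (if (i <= k)%N then (i, k) else (k, i)) (sort_pair_subproof i k).

Lemma sort_pairC i k : sort_pair i k = sort_pair k i.
Proof. by apply: val_inj => /=; case: ltngtP => // /val_inj ->. Qed.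

Lemma sort_pairK (p : Defs.le_pair n) : sort_pair (val p).1 (val p).2 = p.
Proof. by apply: val_inj; case: p => [[i k] /= ->]. Qed.

End SortedPairs.

Section Symbols.

Variables (k : fieldType) (n : nat) (e : k).
Hypothesis ee : e * e = 1.
Local Notation S := {mpoly k[n * n]}.
Local Notation x := (@mxvar k n).
Local Notation eS := (e%:MP : S).

Definition basis_symbol (q : quad_index n) : F1 k n := [ffun q' => (q' == q)%:R].

(* For i != i' and j != j' this lies above X_ij X_i'j' + e X_ij' X_i'j, which is e
   times the quadric of the sorted indices if the pairs are in opposite orders. *)
Definition symbol (i j i' j' : 'I_n) : F1 k n :=
  (if [|| i == i', j == j' | (i < i')%N == (j < j')%N] then 1 else eS) *:
    basis_symbol (sort_pair i i', sort_pair j j').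

Lemma eeS : eS * eS = 1.
Proof. by rewrite -mpolyCM ee. Qed.

Ltac mxring :=
  move: eeS; move: (eS : S) => ?;
  repeat match goal with |- context [@mxvar k n ?i ?j] =>
    move: (@mxvar k n i j) => ? end;
  let H := fresh in move=> H; ring: H.

Section D1.
Variable g : quad_index n -> S^o.

Lemma d1D u v : d1 g (u + v) = d1 g u + d1 g v.
Proof. by rewrite /d1 -big_split; apply: eq_bigr => q _; rewrite ffunE scalerDl. Qed.

Lemma d1Z p u : d1 g (p *: u) = p * d1 g u.
Proof.
by rewrite /d1 big_distrr; apply: eq_bigr => q _; rewrite ffunE -scalerA.
Qed.

Lemma d1B u v : d1 g (u - v) = d1 g u - d1 g v.
Proof. by rewrite -scaleN1r d1D d1Z mulN1r. Qed.

Lemma d1_basis q : d1 g (basis_symbol q) = g q.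
Proof.
rewrite /d1 (bigD1 q) //= ffunE eqxx scale1r big1 ?addr0 // => q' nq.
by rewrite ffunE (negPf nq) scale0r.
Qed.

End D1.

Lemma d1_symbol i j i' j' : d1 (quadric e) (symbol i j i' j') =
  if (i == i') || (j == j') then x i j * x i' j'
  else x i j * x i' j' + eS * (x i j' * x i' j).
Proof.
rewrite /symbol d1Z d1_basis /quadric /= -!(inj_eq val_inj) /=.
have -> : (if (i <= i')%N then (i, i') else (i', i)) =
          ((if (i <= i')%N then i else i'), (if (i <= i')%N then i' else i)).
  by case: ifP.
have -> : (if (j <= j')%N then (j, j') else (j', j)) =
          ((if (j <= j')%N then j else j'), (if (j <= j')%N then j' else j)).
  by case: ifP.
case: (ltngtP i i') => Hi; case: (ltngtP j j') => Hj;
  rewrite ?(val_inj Hi) ?(val_inj Hj) -?(inj_eq val_inj) /=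
    ?(ltn_eqF Hi) ?(gtn_eqF Hi) ?(ltn_eqF Hj) ?(gtn_eqF Hj) ?eqxx ?orbT /=
    -?mul_mpolyC; mxring.
Qed.

Lemma symbolC i j i' j' : symbol i j i' j' = symbol i' j' i j.
Proof.
rewrite /symbol (sort_pairC i) (sort_pairC j) (eq_sym i) (eq_sym j).
rewrite -!(inj_eq val_inj) /=.
by case: (ltngtP i i'); case: (ltngtP j j').
Qed.

Lemma symbol_swap i j i' j' : i != i' -> j != j' ->
  symbol i j' i' j = eS *: symbol i j i' j'.
Proof.
rewrite /symbol (sort_pairC j) (eq_sym j') -!(inj_eq val_inj) /=.
move: (basis_symbol _) eeS; move: (eS : S) => E v EE.
case: (ltngtP i i') => //; case: (ltngtP j j') => //= _ _ _ _.
- by rewrite scalerA mulr1.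
- by rewrite scalerA EE.
- by rewrite scalerA EE.
- by rewrite scalerA mulr1.
Qed.

Lemma symbol_sorted (q : quad_index n) :
  symbol (val q.1).1 (val q.2).1 (val q.1).2 (val q.2).2 = basis_symbol q.
Proof.
rewrite /symbol !sort_pairK -surjective_pairing.
case: q => [p1 p2] /=; have := valP p1; have := valP p2; rewrite /=.
case: (sval p1) (sval p2) => [i i'] [j j'] /=; rewrite -!(inj_eq val_inj) /=.
case: (ltngtP i i') => //; case: (ltngtP j j') => //= _ _ _ _;
  by rewrite scale1r.
Qed.

Lemma coefs_homogD d u v : coefs_homog d u -> coefs_homog d v ->
  coefs_homog (k := k) (n := n) d (u + v).
Proof. by move=> hu hv q; rewrite ffunE rpredD ?hu ?hv. Qed.

Lemma coefs_homogB d u v : coefs_homog d u -> coefs_homog d v ->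
  coefs_homog (k := k) (n := n) d (u - v).
Proof. by move=> hu hv q; rewrite !ffunE rpredB ?hu ?hv. Qed.

Lemma coefs_homogZ d d' p u : p \is d'.-homog -> coefs_homog d u ->
  coefs_homog (k := k) (n := n) (d' + d) (p *: u).
Proof. by move=> hp hu q; rewrite ffunE dhomogM. Qed.

Lemma coefs_homog_symbol i j i' j' : coefs_homog 0 (symbol i j i' j').
Proof.
move=> q; rewrite /symbol !ffunE; apply: (dhomogM (d := 0) (e := 0)).
  case: ifP => _; first exact: dhomog1.
  by rewrite -[_%:MP]mulr1 mul_mpolyC rpredZ ?dhomog1.
by case: eqP => _; [apply: dhomog1|apply: rpred0].
Qed.

Lemma mxvar_homog i j : x i j \is 1.-homog.
Proof. by rewrite dhomogX /= mdeg1. Qed.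

Section Relations.

Variable N : F1 k n -> Prop.
Hypothesis HN : submodule N.
Hypothesis HL : forall u, linear_relation (quadric e) u -> N u.

Lemma linear_relation2 (p1 p2 : S) u1 u2 :
  p1 \is 1.-homog -> p2 \is 1.-homog -> coefs_homog 0 u1 -> coefs_homog 0 u2 ->
  p1 * d1 (quadric e) u1 = p2 * d1 (quadric e) u2 ->
  modulo N (p1 *: u1) (p2 *: u2).
Proof.
move=> h1 h2 hu1 hu2 H; apply: HL; split.
  by rewrite /relation d1B !d1Z H subrr.
by apply: coefs_homogB; apply: (@coefs_homogZ 0 1).
Qed.

Lemma linear_relation3 (p1 p2 p3 : S) u1 u2 u3 :
  p1 \is 1.-homog -> p2 \is 1.-homog -> p3 \is 1.-homog ->
  coefs_homog 0 u1 -> coefs_homog 0 u2 -> coefs_homog 0 u3 ->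
  p1 * d1 (quadric e) u1 = p2 * d1 (quadric e) u2 + p3 * d1 (quadric e) u3 ->
  modulo N (p1 *: u1) (p2 *: u2 + p3 *: u3).
Proof.
move=> h1 h2 h3 hu1 hu2 hu3 H; apply: HL; split.
  by rewrite /relation d1B d1D !d1Z H subrr.
by apply: coefs_homogB; [|apply: coefs_homogD]; apply: (@coefs_homogZ 0 1).
Qed.

Lemma linear_relation4 (p1 p2 p3 p4 : S) u1 u2 u3 u4 :
  p1 \is 1.-homog -> p2 \is 1.-homog -> p3 \is 1.-homog -> p4 \is 1.-homog ->
  coefs_homog 0 u1 -> coefs_homog 0 u2 -> coefs_homog 0 u3 -> coefs_homog 0 u4 ->
  p1 * d1 (quadric e) u1 + p2 * d1 (quadric e) u2 =
    p3 * d1 (quadric e) u3 + p4 * d1 (quadric e) u4 ->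
  modulo N (p1 *: u1 + p2 *: u2) (p3 *: u3 + p4 *: u4).
Proof.
move=> h1 h2 h3 h4 hu1 hu2 hu3 hu4 H; apply: HL; split.
  by rewrite /relation d1B !d1D !d1Z H subrr.
by apply: coefs_homogB; apply: coefs_homogD; apply: (@coefs_homogZ 0 1).
Qed.

(** Both sides of each congruence have the same image under [d1] and coefficients of degree one, so
    their difference is a linear relation. *)
Lemma symbol_relations : basic_relations eS N x symbol.
Proof.
have hx i j : x i j \is 1.-homog by apply: mxvar_homog.
have hex i j : eS * x i j \is 1.-homog by rewrite mul_mpolyC rpredZ ?mxvar_homog.
have hE i j i' j' : coefs_homog 0 (symbol i j i' j').
  by apply: coefs_homog_symbol.
have neqs (i j : 'I_n) : i != j -> (i == j = false) * (j == i = false).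
  by move=> nij; rewrite [j == i]eq_sym (negPf nij).
split=> *; first exact: symbolC.
  exact: symbol_swap.
all: do 1?[apply: linear_relation2 (hx _ _) (hx _ _) (hE _ _ _ _) (hE _ _ _ _) _
  | apply: linear_relation3 (hx _ _) (hx _ _) (hex _ _)
      (hE _ _ _ _) (hE _ _ _ _) (hE _ _ _ _) _
  | apply: linear_relation4 (hx _ _) (hex _ _) (hx _ _) (hex _ _)
      (hE _ _ _ _) (hE _ _ _ _) (hE _ _ _ _) (hE _ _ _ _) _].
all: move: d1_symbol eeS; move: symbol (@mxvar k n) (eS : S) => sy X E d1E EE.
all: rewrite !d1E ?eqxx ?orbT /=.
all: do ?[match goal with H : is_true (_ != _) |- _ =>
  rewrite ?(neqs _ _ H) /=; clear H end].
all: by ring: EE.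
Qed.

End Relations.
End Symbols.

(** * Monomials and their multidegrees *)

Section Monomials.

Variable n : nat.
Local Notation mon := 'X_{1..n * n}.

Definition cell (i j : 'I_n) : mon := U_(mxvec_index i j)%MM.

Definition rowdeg (M : mon) (i : 'I_n) : nat := \sum_j M (mxvec_index i j).
Definition coldeg (M : mon) (j : 'I_n) : nat := \sum_i M (mxvec_index i j).

Lemma mxvec_index_eq (i j i' j' : 'I_n) :
  (mxvec_index i j == mxvec_index i' j') = (i == i') && (j == j').
Proof.
apply/eqP/andP=> [|[/eqP-> /eqP->] //].
by move/cast_ord_inj/enum_rank_inj => [-> ->].
Qed.

Lemma rowdegD M M' i : rowdeg (M + M')%MM i = (rowdeg M i + rowdeg M' i)%N.
Proof. by rewrite -big_split; apply: eq_bigr => j _; rewrite mnmDE. Qed.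

Lemma coldegD M M' j : coldeg (M + M')%MM j = (coldeg M j + coldeg M' j)%N.
Proof. by rewrite -big_split; apply: eq_bigr => i _; rewrite mnmDE. Qed.

Lemma rowdeg_cell i j i' : rowdeg (cell i j) i' = (i == i') :> nat.
Proof.
rewrite /rowdeg; under eq_bigr do rewrite mnm1E mxvec_index_eq.
rewrite (bigD1 j) //= eqxx andbT big1 ?addn0 // => j' nj.
by rewrite [j == _]eq_sym (negPf nj) andbF.
Qed.

Lemma coldeg_cell i j j' : coldeg (cell i j) j' = (j == j') :> nat.
Proof.
rewrite /coldeg; under eq_bigr do rewrite mnm1E mxvec_index_eq.
rewrite (bigD1 i) //= eqxx big1 ?addn0 // => i' ni.
by rewrite [i == _]eq_sym (negPf ni).
Qed.

Definition degE := (rowdegD, coldegD, rowdeg_cell, coldeg_cell).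

Lemma cell_inj i j i' j' : cell i j = cell i' j' -> (i, j) = (i', j').
Proof.
by move/eqP; rewrite eq_mnm1 mxvec_index_eq => /andP[/eqP-> /eqP->].
Qed.

Lemma mnm_gt0 (M : mon) i j : (0 < M (mxvec_index i j))%N ->
  exists m, M = (cell i j + m)%MM.
Proof.
move=> h; exists (M - cell i j)%MM; rewrite addmC submK //.
by rewrite lep1mP -lt0n.
Qed.

Lemma rowdeg_gt0 M i : (0 < rowdeg M i)%N -> exists j m, M = (cell i j + m)%MM.
Proof.
rewrite lt0n sum_nat_eq0 negb_forall => /existsP[j].
by rewrite -lt0n => /mnm_gt0[m ->]; exists j, m.
Qed.

Lemma coldeg_gt0 M j : (0 < coldeg M j)%N -> exists i m, M = (cell i j + m)%MM.
Proof.
rewrite lt0n sum_nat_eq0 negb_forall => /existsP[i].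
by rewrite -lt0n => /mnm_gt0[m ->]; exists i, m.
Qed.

Lemma mnm_neq0 (M : mon) : M != 0%MM -> exists i j m, M = (cell i j + m)%MM.
Proof.
move=> nM; suff [t]: exists t, (0 < M t)%N.
  by case/mxvec_indexP: t => i j /mnm_gt0[m ->]; exists i, j, m.
apply/existsP; apply: contraNT nM; rewrite negb_exists => /forallP h.
by apply/eqP/mnmP => t; rewrite mnm0E; apply/eqP; rewrite -leqn0 leqNgt h.
Qed.

(** Unique factorization in the form used to compare two decompositions of one monomial: the leading
    variables agree, or each occurs in the other cofactor. *)
Lemma mnm1_refine N (a b : 'I_N) (m m' : 'X_{1..N}) :
  (U_(a) + m = U_(b) + m')%MM ->
  a = b /\ m = m' \/ exists m'', m = (U_(b) + m'')%MM /\ m' = (U_(a) + m'')%MM.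
Proof.
have [<-|nab] := eqVneq a b; first by move/addmI; left.
move=> E; right; exists (m - U_(b))%MM.
have h : (U_(b) <= m)%MM.
  rewrite lep1mP; move/mnmP: (E) => /(_ b).
  by rewrite !mnmDE !mnm1E eqxx (negPf nab) add0n => ->.
have Em : (U_(b) + (m - U_(b)) = m)%MM by rewrite addmC submK.
split=> //; apply: (@addmI _ U_(b)%MM).
by rewrite -E addmA [(U_(b) + U_(a))%MM]addmC -addmA Em.
Qed.

Definition sqfree (M : mon) : bool :=
  [forall i, (rowdeg M i <= 1)%N] && [forall j, (coldeg M j <= 1)%N].

Lemma sqfreeP M : reflect ((forall i, rowdeg M i <= 1)%N /\ (forall j, coldeg M j <= 1)%N)
  (sqfree M).
Proof.
apply: (iffP andP) => [[/forallP h1 /forallP h2]|[h1 h2]]; split=> //;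
exact/forallP.
Qed.

Lemma eq_sqfree M M' : rowdeg M =1 rowdeg M' -> coldeg M =1 coldeg M' ->
  sqfree M = sqfree M'.
Proof.
move=> h1 h2; rewrite /sqfree; congr (_ && _); apply: eq_forallb => i.
  by rewrite h1.
by rewrite h2.
Qed.

Local Notation cellp z := (cell z.1 z.2).

Lemma nsqfreeP M : ~~ sqfree M ->
  exists z w m, line z w /\ M = (cellp z + (cellp w + m))%MM.
Proof.
rewrite negb_and !negb_forall => /orP[] /existsP[i]; rewrite -ltnNge => lt.
  have [j [m EM]] := rowdeg_gt0 (ltnW lt).
  move: lt; rewrite EM !degE eqxx => /rowdeg_gt0[j' [m' Em]].
  exists (i, j), (i, j'), m'; rewrite /line /= eqxx; split=> //.
  by rewrite Em.
have [j [m EM]] := coldeg_gt0 (ltnW lt).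
move: lt; rewrite EM !degE eqxx => /coldeg_gt0[j' [m' Em]].
exists (j, i), (j', i), m'; rewrite /line /= eqxx orbT; split=> //.
by rewrite Em.
Qed.

Lemma line_nsqfree z w m : line z w -> ~~ sqfree (cellp z + (cellp w + m))%MM.
Proof.
case: z w => [i j] [i' j']; rewrite /line /= => h; apply/sqfreeP => -[h1 h2].
case/orP: h => /eqP E.
  by have := h1 i; rewrite !degE E !eqxx !addnA.
by have := h2 j; rewrite !degE E !eqxx !addnA.
Qed.

Lemma sqfreeDl m m' : sqfree (m + m')%MM -> sqfree m'.
Proof.
move/sqfreeP => [h1 h2]; apply/sqfreeP; split=> i.
  by apply: leq_trans (h1 i); rewrite rowdegD leq_addl.
by apply: leq_trans (h2 i); rewrite coldegD leq_addl.
Qed.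

Lemma cell_refine (z w : 'I_n * 'I_n) m m' :
  (cellp z + m = cellp w + m')%MM ->
  z = w /\ m = m' \/ exists m'', m = (cellp w + m'')%MM /\ m' = (cellp z + m'')%MM.
Proof.
case: z w => [i j] [i' j'] /mnm1_refine[[E ->]|]; last by right.
by left; split=> //; apply: cell_inj; rewrite /cell E.
Qed.

Lemma sqfree_neq M i j i' j' m : sqfree M ->
  M = (cell i j + (cell i' j' + m))%MM -> (i != i') /\ (j != j').
Proof.
move=> sqM EM; apply/andP; rewrite -negb_or; apply: contraL sqM => h.
by rewrite EM; apply: (@line_nsqfree (i, j) (i', j')).
Qed.

End Monomials.

(** * Lifting monomials to the free module *)

Section Modulo.

Variables (S : comNzRingType) (Q : finType) (N : {ffun Q -> S^o} -> Prop).
Hypothesis HN : submodule N.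

Lemma modulo_refl u : modulo N u u.
Proof. by rewrite /modulo subrr; apply: sub0. Qed.

Lemma modulo_trans v u w : modulo N u v -> modulo N v w -> modulo N u w.
Proof. by move=> h1 h2; have := subD HN h1 h2; rewrite addrA subrK. Qed.

Lemma moduloZ p u v : modulo N u v -> modulo N (p *: u) (p *: v).
Proof. by move=> h; rewrite /modulo -scalerBr; apply: subZ. Qed.

Lemma moduloD u v u' v' : modulo N u v -> modulo N u' v' ->
  modulo N (u + u') (v + v').
Proof. by move=> h1 h2; rewrite /modulo opprD addrACA; apply: subD. Qed.

End Modulo.

Ltac mnm_ac :=
  apply/mnmP; let t := fresh in move=> t; rewrite !mnmDE;
  repeat match goal with |- context [fun_of_multinom ?m t] =>
    move: (fun_of_multinom m t) end; clear; lia.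

Section Splitting.

Variables (S : comNzRingType) (Q : finType) (n : nat) (e : S).
Variable N : {ffun Q -> S^o} -> Prop.
Variables (x : 'I_n -> 'I_n -> S) (X : 'X_{1..n * n} -> S).
Variable E : 'I_n -> 'I_n -> 'I_n -> 'I_n -> {ffun Q -> S^o}.
Hypotheses (ee : e * e = 1) (HN : submodule N) (HE : basic_relations e N x E).
Hypotheses (four : four_relations N x E)
  (fourT : four_relations N (fun j i => x i j) (fun j i l k => E i j k l)).
Hypothesis XcellD : forall i j m, X (cell i j + m)%MM = x i j * X m.
Local Notation cellp z := (cell z.1 z.2).
Local Notation Ep z w := (E z.1 z.2 w.1 w.2).

(** The two pairs of cells coincide, share one cell, or occupy disjoint factors of the monomial.
    Only the last case is a Koszul relation and calls on [four] and [fourT]. *)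
Lemma line_unique z w m z' w' m' : line z w -> line z' w' ->
  (cellp z + (cellp w + m) = cellp z' + (cellp w' + m'))%MM ->
  modulo N (X m *: Ep z w) (X m' *: Ep z' w').
Proof.
have lineC (u v : 'I_n * 'I_n) : line u v = line v u.
  by rewrite /line eq_sym [_.2 == _]eq_sym.
have share u v v' p : line u v -> line u v' ->
    modulo N (X (cellp v' + p)%MM *: Ep u v) (X (cellp v + p)%MM *: Ep u v').
  move=> l l'; rewrite !XcellD ![x _ _ * _]mulrC -!scalerA.
  by apply: (moduloZ HN); apply: (line_share HN HE).
move=> lzw lzw' /cell_refine[[Ez /cell_refine[[Ew Em]|[p [-> ->]]]]|[m1 []]].
- by subst; apply: (modulo_refl HN).
- by subst; apply: share.
move=> /cell_refine[[Ew <-]|[p [-> ->]]].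
  subst w; rewrite (relC HE z.1).
  case/cell_refine=> [[Ez Em]|[p [-> ->]]]; first by subst; apply: (modulo_refl HN).
  by apply: share; rewrite // lineC.
case/cell_refine=> [[Ez ->]|[q [-> /cell_refine[[Ew ->]|[r [-> ->]]]]]].
- by subst w'; rewrite (relC HE z'.1); apply: share; rewrite // lineC.
- subst w'; rewrite (relC HE z.1) (relC HE z'.1).
  by apply: share; rewrite // lineC.
have rot (a b c : S) : a * (b * c) = c * (a * b) by rewrite mulrA mulrC.
have := moduloZ HN (X r) (line_line HN ee HE four fourT lzw lzw').
by rewrite !XcellD [x z'.1 _ * (_ * _)]rot [x z.1 _ * (_ * _)]rot !scalerA.
Qed.

Lemma edge_near_line j a k' b u m : j != k' -> a != b -> line u (j, a) ->
  exists z w p z' w' p',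
  [/\ line z w,
      (cell j a + (cell k' b + (cellp u + m)) = cellp z + (cellp w + p))%MM,
      line z' w',
      (cell j b + (cell k' a + (cellp u + m)) = cellp z' + (cellp w' + p'))%MM
    & modulo N (X (cellp u + m)%MM *: E j a k' b)
               (X p *: Ep z w + (e * X p') *: Ep z' w')].
Proof.
case: u => [i c] njk nab; rewrite /line /= => /orP[]/eqP ->.
  exists (j, c), (j, a), (cell k' b + m)%MM, (j, c), (j, b), (cell k' a + m)%MM.
  split; rewrite /line /= ?eqxx //; try by mnm_ac.
  have := moduloZ HN (X m) (rel_edge_row HE c njk nab).
  rewrite !XcellD scalerDr !scalerA ![X m * _]mulrC.
  by rewrite -[e * x k' a * X m]mulrA.
exists (i, a), (j, a), (cell k' b + m)%MM, (i, a), (k', a), (cell j b + m)%MM.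
split; rewrite /line /= ?eqxx ?orbT //; try by mnm_ac.
have := moduloZ HN (X m) (rel_edge_col HE i njk nab).
rewrite !XcellD scalerDr !scalerA ![X m * _]mulrC.
by rewrite -[e * x j b * X m]mulrA.
Qed.

(** Two cells on a line divide the first monomial. They cannot be the two cells of the edge; if one
    of them is, the edge expands along that line, and if both lie in [m], the Koszul relation
    [line_edge] applies. Either way a line is found in both monomials of the edge. *)
Lemma edge_nsqfree j a k' b m : j != k' -> a != b ->
  ~~ sqfree (cell j a + (cell k' b + m))%MM ->
  exists z w p z' w' p',
  [/\ line z w, (cell j a + (cell k' b + m) = cellp z + (cellp w + p))%MM,
      line z' w', (cell j b + (cell k' a + m) = cellp z' + (cellp w' + p'))%MM
    & modulo N (X m *: E j a k' b) (X p *: Ep z w + (e * X p') *: Ep z' w')].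
Proof.
have lineC (u v : 'I_n * 'I_n) : line u v = line v u.
  by rewrite /line eq_sym [_.2 == _]eq_sym.
move=> njk nab /nsqfreeP[z [w [p [lzw]]]].
have near1 u q : m = (cellp u + q)%MM -> line u (j, a) -> exists z w p z' w' p',
  [/\ line z w, (cell j a + (cell k' b + m) = cellp z + (cellp w + p))%MM,
      line z' w', (cell j b + (cell k' a + m) = cellp z' + (cellp w' + p'))%MM
    & modulo N (X m *: E j a k' b) (X p *: Ep z w + (e * X p') *: Ep z' w')].
  by move=> ->; apply: edge_near_line.
have near2 u q : m = (cellp u + q)%MM -> line u (k', b) -> exists z w p z' w' p',
  [/\ line z w, (cell j a + (cell k' b + m) = cellp z + (cellp w + p))%MM,
      line z' w', (cell j b + (cell k' a + m) = cellp z' + (cellp w' + p'))%MM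
    & modulo N (X m *: E j a k' b) (X p *: Ep z w + (e * X p') *: Ep z' w')].
  rewrite eq_sym in njk; rewrite eq_sym in nab.
  move=> -> lu; have := edge_near_line q njk nab lu.
  case=> z' [w' [p1 [z'' [w'' [p2 [l1 E1 l2 E2 h]]]]]].
  exists z', w', p1, z'', w'', p2; rewrite (relC HE j) -E1 -E2.
  by split=> //; mnm_ac.
case/(@cell_refine _ (j, a)) => [[Ez]|[m1 []]].
  subst z; case/(@cell_refine _ (k', b)) => [[Ew]|[q [Em _]]].
    by subst w; move: lzw; rewrite /line /= (negPf njk) (negPf nab).
  by apply: near1 Em _; rewrite lineC.
case/(@cell_refine _ (k', b)) => [[Ez <-]|[m2 [Em ->]]].
  subst z; case/cell_refine=> [[Ew]|[q [_ Em]]].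
    by move: lzw; rewrite Ew lineC /line /= (negPf njk) (negPf nab).
  by apply: near2 Em _; rewrite lineC.
case/cell_refine=> [[Ew _]|[m3 [_]]]; first by apply: near1 Em _; rewrite -Ew.
case/(@cell_refine _ (k', b)) => [[Ew _]|[m4 [Em2 _]]].
  by apply: near2 Em _; rewrite Ew.
exists z, w, (cell j a + (cell k' b + m4))%MM.
exists z, w, (cell j b + (cell k' a + m4))%MM.
rewrite Em Em2.
split=> //; try by mnm_ac.
have := moduloZ HN (X m4) (line_edge HN ee HE lzw njk nab).
rewrite !XcellD !scalerA -scalerDl.
have -> : x z.1 z.2 * (x w.1 w.2 * X m4) = X m4 * (x z.1 z.2 * x w.1 w.2).
  by rewrite mulrA mulrC.
suff -> : x j a * (x k' b * X m4) + e * (x j b * (x k' a * X m4)) =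
  X m4 * (x j a * x k' b + e * x j b * x k' a) by [].
by ring.
Qed.

(** The choice sees only row and column degrees, so all monomials of one multidegree are steered
    towards the same cell. *)
Definition corner (M : 'X_{1..n * n}) : option ('I_n * 'I_n) :=
  [pick p | (0 < rowdeg M p.1)%N && (0 < coldeg M p.2)%N].

Lemma eq_corner M M' : rowdeg M =1 rowdeg M' -> coldeg M =1 coldeg M' ->
  corner M = corner M'.
Proof. by move=> h1 h2; apply: eq_pick => p /=; rewrite h1 h2. Qed.

(* Sends a square-free monomial M to the coefficients of a chain of edges that
   leads from M to a monomial depending only on the row and column degrees of M:
   the variable at the corner of M is moved into place by one edge, and the
   process is repeated on the other variables. *)
Fixpoint chain (d : nat) (M : 'X_{1..n * n}) : {ffun Q -> S^o} :=
  if d isn't d'.+1 then 0 else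
  if corner M isn't Some (i0, j0) then 0 else
  if (0 < M (mxvec_index i0 j0))%N then
    x i0 j0 *: chain d' (M - cell i0 j0)%MM
  else if [pick q : 'I_n * 'I_n | (cell i0 q.2 + cell q.1 j0 <= M)%MM] isn't
    Some (r, c) then 0
  else let m := (M - (cell i0 c + cell r j0))%MM in
    X m *: E i0 c r j0 - (e * x i0 j0) *: chain d' (cell r c + m)%MM.

Lemma chain_corner d i0 j0 m : corner (cell i0 j0 + m)%MM = Some (i0, j0) ->
  chain d.+1 (cell i0 j0 + m)%MM = x i0 j0 *: chain d m.
Proof.
by move=> /= ->; rewrite mnmDE mnm1E eqxx /= addmC addmK.
Qed.

(** In a square-free monomial the cell in row [i0] and the cell in column [j0] are unique, so the
    [pick] in [chain] can only return r and c. *)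
Lemma chain_edge d i0 j0 r c m (M := (cell i0 c + (cell r j0 + m))%MM) :
  sqfree M -> corner M = Some (i0, j0) -> r != i0 -> c != j0 ->
  chain d.+1 M =
    X m *: E i0 c r j0 - (e * x i0 j0) *: chain d (cell r c + m)%MM.
Proof.
move=> sqM cM nr nc; rewrite /= cM; have neq := sqfree_neq sqM.
have rowM c' p : M = (cell i0 c' + p)%MM -> c' = c.
  move=> EM; case/(@cell_refine _ (i0, c) (i0, c')): (EM) => [[[]]|[q [_ Ep]]] //.
  by have [|] := neq i0 c' i0 c q; [rewrite EM Ep|rewrite eqxx].
have colM r' p : M = (cell r' j0 + p)%MM -> r' = r.
  move=> EM; have EM' : M = (cell r j0 + (cell i0 c + m))%MM by rewrite /M; mnm_ac.
  move: (EM); rewrite {1}EM'.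
  case/(@cell_refine _ (r, j0) (r', j0)) => [[[]]|[q [_ Ep]]] //.
  by have [|_] := neq r' j0 r j0 q; [rewrite EM Ep|rewrite eqxx].
rewrite ifN; last by apply/negP => /mnm_gt0[p /rowM Ec]; rewrite Ec eqxx in nc.
case: pickP => [[r' c'] /= le|/(_ (r, c)) /=]; last first.
  by rewrite /M addmA lem_addr.
have EM := submK le; rewrite addmC -addmA in EM.
have Ec := rowM _ _ (esym EM); have Er : r' = r.
  apply: (colM _ (cell i0 c' + (M - (cell i0 c' + cell r' j0)))%MM).
  by rewrite -{1}EM; mnm_ac.
subst c' r'; have -> // : (M - (cell i0 c + cell r j0) = m)%MM.
by rewrite /M addmA [(_ + m)%MM]addmC addmK.
Qed.

Section EdgeStep.

Variable d : nat.
Hypothesis IH : forall m (j a k b : 'I_n), j != k -> a != b ->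
  sqfree (cell j a + (cell k b + m))%MM -> (mdeg m).+2 = d ->
  modulo N (X m *: E j a k b) (chain d (cell j a + (cell k b + m))%MM +
                               e *: chain d (cell j b + (cell k a + m))%MM).

Definition edge_ok m j a k b :=
  modulo N (X m *: E j a k b) (chain d.+1 (cell j a + (cell k b + m))%MM +
                               e *: chain d.+1 (cell j b + (cell k a + m))%MM).

Lemma corner_swap m (j a k b : 'I_n) :
  corner (cell j b + (cell k a + m))%MM = corner (cell j a + (cell k b + m))%MM.
Proof. by apply: eq_corner => t; rewrite !degE; lia. Qed.

Lemma sqfree_swap m (j a k b : 'I_n) :
  sqfree (cell j b + (cell k a + m))%MM = sqfree (cell j a + (cell k b + m))%MM.
Proof. by apply: eq_sqfree => t; rewrite !degE; lia. Qed.

Lemma edge_okC m (j a k b : 'I_n) : edge_ok m k b j a -> edge_ok m j a k b.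
Proof.
rewrite /edge_ok (relC HE j).
have -> : (cell k b + (cell j a + m) = cell j a + (cell k b + m))%MM by mnm_ac.
by have -> : (cell k a + (cell j b + m) = cell j b + (cell k a + m))%MM by mnm_ac.
Qed.

Lemma edge_ok_swap m (j a k b : 'I_n) : j != k -> a != b ->
  edge_ok m j b k a -> edge_ok m j a k b.
Proof.
move=> njk nab; rewrite eq_sym in nab.
rewrite /edge_ok (rel_swap HE njk nab) => /(moduloZ HN e).
by rewrite scalerA mulrC -scalerA scalerDr [e *: (e *: _)]scalerA ee scale1r addrC.
Qed.

Ltac coords :=
  apply/ffunP=> ?; rewrite !ffunE /GRing.scale /=;
  repeat match goal with
  | |- context [E ?i ?j ?k ?l] => move: (E i j k l) => ?
  | |- context [chain ?d ?M] => move: (chain d M) => ?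
  | |- context [x ?i ?j] => move: (x i j) => ?
  | |- context [X ?m] => move: (X m) => ?
  end; ring: ee.

(** The first monomial has the corner variable in place, and the chain of the second one begins with
    this very edge; the two sides are even equal. *)
Lemma edge_ok_corner m (j a k b : 'I_n) : j != k -> a != b ->
  sqfree (cell j a + (cell k b + m))%MM ->
  corner (cell j a + (cell k b + m))%MM = Some (j, a) -> edge_ok m j a k b.
Proof.
move=> njk nab sqM cM; rewrite /edge_ok chain_corner //.
rewrite -sqfree_swap in sqM; rewrite -corner_swap in cM.
have nkj : k != j by rewrite eq_sym.
rewrite eq_sym in nab; rewrite (chain_edge d sqM cM nkj nab); rewrite (rel_swap HE njk nab).
suff -> : X m *: (e *: E j b k a) = x j a *: chain d (cell k b + m)%MM +
  e *: (X m *: E j b k a - (e * x j a) *: chain d (cell k b + m)%MM).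
  exact: (modulo_refl HN).
coords.
Qed.

(** The corner lies in row j, but its column is occupied in a third row r. The given edge and the
    first edges of both chains fit into one cycle on rows j, r, k, which leaves an edge between rows
    r and k of smaller degree. *)
Lemma edge_ok_row m (j a k b : 'I_n) (r j0 : 'I_n) : j != k -> a != b ->
  (mdeg (cell r j0 + m)%MM).+2 = d.+1 ->
  sqfree (cell j a + (cell k b + (cell r j0 + m)))%MM ->
  corner (cell j a + (cell k b + (cell r j0 + m)))%MM = Some (j, j0) ->
  a != j0 -> b != j0 ->
  edge_ok (cell r j0 + m)%MM j a k b.
Proof.
move=> njk nab dm sqM cM naj nbj.
have [njr _] : j != r /\ a != j0.
  by apply: (sqfree_neq (m := (cell k b + m)%MM) sqM); mnm_ac.
have [nrk _] : r != k /\ j0 != b.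
  by apply: (sqfree_neq (m := (cell j a + m)%MM) sqM); mnm_ac.
have sqM' := sqM; rewrite -sqfree_swap in sqM'.
have cM' := cM; rewrite -corner_swap in cM'.
rewrite /edge_ok.
have E1 : (cell j a + (cell k b + (cell r j0 + m)) =
  cell j a + (cell r j0 + (cell k b + m)))%MM by mnm_ac.
have E2 : (cell j b + (cell k a + (cell r j0 + m)) =
  cell j b + (cell r j0 + (cell k a + m)))%MM by mnm_ac.
rewrite E1 in sqM cM *; rewrite E2 in sqM' cM' *.
rewrite !chain_edge //; try by rewrite eq_sym.
have sqIH : sqfree (cell r a + (cell k b + m))%MM.
  apply/sqfreeP; case/sqfreeP: sqM => h1 h2; split=> t.
    by move: (h1 t); rewrite !degE; clear; lia.
  by move: (h2 t); rewrite !degE; clear; lia.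
have dIH : (mdeg m).+2 = d by move: dm; rewrite mdegD mdeg1 => -[].
apply: (lincomb2 HN (p1 := X m) (p2 := - (e * x j j0))
  (rel_cycle_row HE njr njk nrk naj nab _) (IH nrk nab sqIH dIH)).
  by rewrite eq_sym.
rewrite !XcellD; coords.
Qed.

Lemma edge_ok_col m (j a k b : 'I_n) (i0 c : 'I_n) : j != k -> a != b ->
  (mdeg (cell i0 c + m)%MM).+2 = d.+1 ->
  sqfree (cell j a + (cell k b + (cell i0 c + m)))%MM ->
  corner (cell j a + (cell k b + (cell i0 c + m)))%MM = Some (i0, a) ->
  j != i0 -> k != i0 ->
  edge_ok (cell i0 c + m)%MM j a k b.
Proof.
move=> njk nab dm sqM cM nji nki.
have [_ nac] : j != i0 /\ a != c.
  by apply: (sqfree_neq (m := (cell k b + m)%MM) sqM); mnm_ac.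
have [_ ncb] : i0 != k /\ c != b.
  by apply: (sqfree_neq (m := (cell j a + m)%MM) sqM); mnm_ac.
have sqM' := sqM; rewrite -sqfree_swap in sqM'.
have cM' := cM; rewrite -corner_swap in cM'.
rewrite /edge_ok.
have E1 : (cell j a + (cell k b + (cell i0 c + m)) =
  cell i0 c + (cell j a + (cell k b + m)))%MM by mnm_ac.
have E2 : (cell j b + (cell k a + (cell i0 c + m)) =
  cell i0 c + (cell k a + (cell j b + m)))%MM by mnm_ac.
rewrite E1 in sqM cM *; rewrite E2 in sqM' cM' *.
rewrite !chain_edge //; try by rewrite eq_sym.
have sqIH : sqfree (cell j c + (cell k b + m))%MM.
  apply/sqfreeP; case/sqfreeP: sqM => h1 h2; split=> t.
    by move: (h1 t); rewrite !degE; clear; lia.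
  by move: (h2 t); rewrite !degE; clear; lia.
have dIH : (mdeg m).+2 = d by move: dm; rewrite mdegD mdeg1 => -[].
have E3 : (cell k c + (cell j b + m) = cell j b + (cell k c + m))%MM by mnm_ac.
rewrite E3 (relC HE i0 c j a) (relC HE i0 c k a).
rewrite eq_sym in nki.
apply: (lincomb2 HN (p1 := X m) (p2 := - (e * x i0 a))
  (rel_cycle_col HE nji njk nki nac nab ncb) (IH njk ncb sqIH dIH)).
rewrite !XcellD; coords.
Qed.

(** Both chains begin with the same exchange, disjoint from the given edge; [edge_edge] lets the two
    commute, and the given edge remains in smaller degree. *)
Lemma edge_ok_far m (j a k b : 'I_n) (i0 j0 c r : 'I_n) : j != k -> a != b ->
  (mdeg (cell i0 c + (cell r j0 + m))%MM).+2 = d.+1 ->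
  sqfree (cell j a + (cell k b + (cell i0 c + (cell r j0 + m))))%MM ->
  corner (cell j a + (cell k b + (cell i0 c + (cell r j0 + m))))%MM = Some (i0, j0) ->
  edge_ok (cell i0 c + (cell r j0 + m))%MM j a k b.
Proof.
move=> njk nab dm sqM cM.
have neq i1 j1 i2 j2 p := sqfree_neq (i := i1) (j := j1) (i' := i2) (j' := j2)
  (m := p) sqM.
have [nji nac] : j != i0 /\ a != c.
  by apply: (neq _ _ _ _ (cell k b + (cell r j0 + m))%MM); mnm_ac.
have [nki nbc] : k != i0 /\ b != c.
  by apply: (neq _ _ _ _ (cell j a + (cell r j0 + m))%MM); mnm_ac.
have [njr naj] : j != r /\ a != j0.
  by apply: (neq _ _ _ _ (cell k b + (cell i0 c + m))%MM); mnm_ac.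
have [nkr nbj] : k != r /\ b != j0.
  by apply: (neq _ _ _ _ (cell j a + (cell i0 c + m))%MM); mnm_ac.
have [nir ncj] : i0 != r /\ c != j0.
  by apply: (neq _ _ _ _ (cell j a + (cell k b + m))%MM); mnm_ac.
have sqM' := sqM; rewrite -sqfree_swap in sqM'.
have cM' := cM; rewrite -corner_swap in cM'.
rewrite /edge_ok.
have E1 : (cell j a + (cell k b + (cell i0 c + (cell r j0 + m))) =
  cell i0 c + (cell r j0 + (cell j a + (cell k b + m))))%MM by mnm_ac.
have E2 : (cell j b + (cell k a + (cell i0 c + (cell r j0 + m))) =
  cell i0 c + (cell r j0 + (cell j b + (cell k a + m))))%MM by mnm_ac.
rewrite E1 in sqM cM *; rewrite E2 in sqM' cM' *.
rewrite !chain_edge //; try by rewrite eq_sym.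
have sqIH : sqfree (cell j a + (cell k b + (cell r c + m)))%MM.
  apply/sqfreeP; case/sqfreeP: sqM => h1 h2; split=> t.
    by move: (h1 t); rewrite !degE; clear; lia.
  by move: (h2 t); rewrite !degE; clear; lia.
have dIH : (mdeg (cell r c + m)).+2 = d.
  by move: dm; rewrite !mdegD !mdeg1 => -[].
have F1 : (cell r c + (cell j a + (cell k b + m)) =
  cell j a + (cell k b + (cell r c + m)))%MM by mnm_ac.
have F2 : (cell r c + (cell j b + (cell k a + m)) =
  cell j b + (cell k a + (cell r c + m)))%MM by mnm_ac.
rewrite F1 F2.
have uniq_rows : uniq [:: i0; r; j; k].
  by rewrite /= !inE !negb_or nir [i0 == j]eq_sym nji [i0 == k]eq_sym nki
    [r == j]eq_sym njr [r == k]eq_sym nkr njk.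
have uniq_cols : uniq [:: c; j0; a; b].
  by rewrite /= !inE !negb_or ncj [c == a]eq_sym nac [c == b]eq_sym nbc
    [j0 == a]eq_sym naj [j0 == b]eq_sym nbj nab.
apply: (lincomb2 HN (p1 := X m) (p2 := - (e * x i0 j0))
  (edge_edge HN ee HE uniq_rows uniq_cols) (IH njk nab sqIH dIH)).
rewrite !XcellD; coords.
Qed.

(** The cases ask whether the corner row is one of j, k and the corner column one of a, b. If both
    are, the edge is itself a step of a chain; if exactly one is, a three-by-three cycle is used; if
    neither is, the edge is disjoint from the corner move. *)
Lemma edge_ok_step m (j a k b : 'I_n) : j != k -> a != b ->
  sqfree (cell j a + (cell k b + m))%MM -> (mdeg m).+2 = d.+1 ->
  edge_ok m j a k b.
Proof.
move=> njk nab sqM dm; have nkj : k != j by rewrite eq_sym.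
have nba : b != a by rewrite eq_sym.
have C t t' : (cell k t' + (cell j t + m) = cell j t + (cell k t' + m))%MM by mnm_ac.
have [i0 [j0 [cM ri cj]]] : exists i0 j0,
    [/\ corner (cell j a + (cell k b + m))%MM = Some (i0, j0),
     (0 < rowdeg (cell j a + (cell k b + m)) i0)%N &
     (0 < coldeg (cell j a + (cell k b + m)) j0)%N].
  rewrite {1}/corner; case: pickP => [[i0 j0] /= /andP[ri cj]|/(_ (j, a)) /=].
    by exists i0, j0.
  by rewrite !degE !eqxx.
have cM' : corner (cell j b + (cell k a + m))%MM = Some (i0, j0).
  by rewrite corner_swap.
have sqM' : sqfree (cell j b + (cell k a + m))%MM by rewrite sqfree_swap.
have [Ej|nji] := eqVneq j i0; last have [Ek|nki] := eqVneq k i0.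
- subst i0; have [Ea|naj] := eqVneq a j0; last have [Eb|nbj] := eqVneq b j0.
  + by subst j0; apply: edge_ok_corner.
  + by subst j0; apply: edge_ok_swap => //; apply: edge_ok_corner.
  + move: cj; rewrite !degE (negPf naj) (negPf nbj) => /coldeg_gt0[r [p Em]].
    by rewrite Em in dm sqM cM *; apply: edge_ok_row.
- subst i0; apply: edge_okC.
  have [Ea|naj] := eqVneq a j0; last have [Eb|nbj] := eqVneq b j0.
  + by subst j0; apply: edge_ok_swap => //; apply: edge_ok_corner; rewrite ?C.
  + by subst j0; apply: edge_ok_corner; rewrite ?C.
  + move: cj; rewrite !degE (negPf naj) (negPf nbj) => /coldeg_gt0[r [p Em]].
    by rewrite -!C in sqM cM; rewrite Em in dm sqM cM *; apply: edge_ok_row.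
- move: ri; rewrite !degE (negPf nji) (negPf nki) => /rowdeg_gt0[c [p Em]].
  have [Ea|naj] := eqVneq a j0; last have [Eb|nbj] := eqVneq b j0.
  + by subst j0; rewrite Em in dm sqM cM *; apply: edge_ok_col.
  + subst j0; apply: edge_okC; rewrite -!C in sqM cM.
    by rewrite Em in dm sqM cM *; apply: edge_ok_col.
  + move: cj; rewrite !degE (negPf naj) (negPf nbj) Em !degE.
    rewrite {}Em in dm sqM cM sqM' cM' *.
    have [Ec _|ncj] := eqVneq c j0; last first.
      move=> /coldeg_gt0[r [q Ep]].
      by rewrite Ep in dm sqM cM *; apply: edge_ok_far.
    (* The corner variable is already in place, so both chains merely divide by it. *)
    subst c; rewrite /edge_ok.
    have E1 : (cell j a + (cell k b + (cell i0 j0 + p)) =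
      cell i0 j0 + (cell j a + (cell k b + p)))%MM by mnm_ac.
    have E2 : (cell j b + (cell k a + (cell i0 j0 + p)) =
      cell i0 j0 + (cell j b + (cell k a + p)))%MM by mnm_ac.
    rewrite E1 in sqM cM *; rewrite E2 in cM' *.
    rewrite !chain_corner // XcellD -scalerA [e *: (_ *: _)]scalerA [e * _]mulrC
      -[(_ * e) *: _]scalerA.
    rewrite -scalerDr; apply: (moduloZ HN); apply: IH => //.
      exact: sqfreeDl sqM.
    by move: dm; rewrite mdegD mdeg1 => -[].
Qed.

End EdgeStep.

Lemma chain_edges d m (j a k b : 'I_n) : j != k -> a != b ->
  sqfree (cell j a + (cell k b + m))%MM -> (mdeg m).+2 = d ->
  modulo N (X m *: E j a k b) (chain d (cell j a + (cell k b + m))%MM +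
                               e *: chain d (cell j b + (cell k a + m))%MM).
Proof.
elim: d m j a k b => [//|d IH] m j a k b njk nab sqM dm.
exact: (edge_ok_step IH).
Qed.

(* [lifting] splits d1 modulo N: it maps each monomial of the ideal of quadrics to
   an element of F_1 lying above it, up to the chosen monomial of its degree. *)
Definition lifting (M : 'X_{1..n * n}) : {ffun Q -> S^o} :=
  if sqfree M then chain (mdeg M) M else
  if [pick p : ('I_n * 'I_n) * ('I_n * 'I_n) |
      line p.1 p.2 && (cellp p.1 + cellp p.2 <= M)%MM] is Some p
  then X (M - (cellp p.1 + cellp p.2))%MM *: Ep p.1 p.2 else 0.

Lemma lifting_line z w m : line z w ->
  modulo N (X m *: Ep z w) (lifting (cellp z + (cellp w + m))%MM).
Proof.
move=> lzw; rewrite /lifting (negPf (line_nsqfree m lzw)).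
case: pickP => [[z' w'] /= /andP[lzw' /submK EM]|/(_ (z, w)) /=].
  by apply: line_unique => //; rewrite -{1}EM addmC -addmA.
by rewrite lzw addmA lem_addr.
Qed.

Lemma lifting_edge m (j a k b : 'I_n) : j != k -> a != b ->
  modulo N (X m *: E j a k b) (lifting (cell j a + (cell k b + m))%MM +
                               e *: lifting (cell j b + (cell k a + m))%MM).
Proof.
move=> njk nab; have [sqM|nsqM] := boolP (sqfree (cell j a + (cell k b + m))%MM).
  rewrite /lifting sqM sqfree_swap sqM.
  have -> : mdeg (cell j b + (cell k a + m))%MM = mdeg (cell j a + (cell k b + m))%MM.
    by rewrite !mdegD !mdeg1.
  by apply: chain_edges; rewrite // !mdegD !mdeg1.
have [z [w [p [z' [w' [p' [l1 -> l2 -> h]]]]]]] := edge_nsqfree njk nab nsqM.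
apply: modulo_trans h _ => //; rewrite -scalerA.
by apply: (moduloD HN); rewrite -/(modulo _ _ _); [|apply: (moduloZ HN)];
  apply: lifting_line.
Qed.

End Splitting.

(** * Generation of the relations *)

Section Extension.

Variables (R : nzRingType) (N : nat) (V : zmodType) (f : 'X_{1..N} -> R -> V).
Hypothesis fD : forall m, {morph f m : a b / a + b}.

(** Additive extension from terms to polynomials. The target is only an abelian group, as the
    construction serves maps into [F1], a module over S, and into k. *)
Definition extension (p : {mpoly R[N]}) : V := \sum_(m <- msupp p) f m p@_m.

Let f0 m : f m 0 = 0.
Proof. by apply: (addIr (f m 0)); rewrite -fD !add0r. Qed.

Lemma extensionwE b p : (msize p <= b)%N ->
  extension p = \sum_(m : 'X_{1..N < b}) f m p@_m.
Proof.
move=> le_pb; rewrite /extension (big_mksub 'X_{1..N < b}) ?msupp_uniq //=.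
  by rewrite big_rmcond //= => m /memN_msupp_eq0 ->.
by move=> m /msize_mdeg_lt /leq_trans; apply.
Qed.

Lemma extensionD : {morph extension : p q / p + q}.
Proof.
move=> p q; set b := maxn (msize p) (maxn (msize q) (msize (p + q))).
rewrite !(@extensionwE b) ?leq_max ?leqnn ?orbT // -big_split.
by apply: eq_bigr => m _; rewrite mcoeffD fD.
Qed.

Lemma extensionZX c m : extension (c *: 'X_[m]) = f m c.
Proof.
have [->|nz] := eqVneq c 0.
  by rewrite scale0r /extension msupp0 big_nil f0.
by rewrite /extension msuppMCX // big_seq1 mcoeffZ mcoeffX eqxx mulr1.
Qed.

Lemma extension0 : extension 0 = 0.
Proof. by rewrite /extension msupp0 big_nil. Qed.

Lemma extension_sum (I : Type) (r : seq I) (P : pred I) (F : I -> {mpoly R[N]}) :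
  extension (\sum_(i <- r | P i) F i) = \sum_(i <- r | P i) extension (F i).
Proof. exact: (big_morph _ extensionD extension0). Qed.

End Extension.

Lemma ffun_basis (S : comNzRingType) (Q : finType) (v : {ffun Q -> S^o}) :
  v = \sum_q v q *: [ffun q' => (q' == q)%:R].
Proof.
apply/ffunP=> q; rewrite sum_ffunE (bigD1 q) //= !ffunE eqxx.
rewrite big1 ?addr0 => [|q' nq]; first by rewrite /GRing.scale /= mulr1.
by rewrite !ffunE eq_sym (negPf nq) scaler0.
Qed.

Section Generation.

Variables (k : fieldType) (n : nat) (e : k) (N : F1 k n -> Prop).
Hypotheses (ee : e * e = 1) (HN : submodule N).
Hypothesis HL : forall u, linear_relation (quadric e) u -> N u.
Local Notation S := {mpoly k[n * n]}.
Local Notation x := (@mxvar k n).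
Local Notation E := (@symbol k n e).
Hypotheses (four : four_relations N x E)
  (fourT : four_relations N (fun j i => x i j) (fun j i l k => E i j k l)).

Lemma modulo_sum (I : Type) (r : seq I) (P : pred I) (F G : I -> F1 k n) :
  (forall i, P i -> modulo N (F i) (G i)) ->
  modulo N (\sum_(i <- r | P i) F i) (\sum_(i <- r | P i) G i).
Proof.
move=> h; elim/big_ind2: _ => //; first exact: (modulo_refl HN).
by move=> *; apply: (moduloD HN).
Qed.

Lemma relations_generated u : relation (quadric e) u -> N u.
Proof.
have HE := symbol_relations ee HL.
have XD i j m : 'X_[cell i j + m] = x i j * 'X_[m] :> S by apply: mpolyXD.
pose lft := lifting (e%:MP : S) x (fun m => 'X_[m]) E.
pose L : S -> F1 k n := extension (fun m c => (c%:MP : S) *: lft m).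
have LD : {morph L : p q / p + q}.
  by apply: extensionD => m a b; rewrite mpolyCD scalerDl.
have LZX c m : L (c *: 'X_[m]) = (c%:MP : S) *: lft m.
  by apply: extensionZX => m' a b; rewrite mpolyCD scalerDl.
have L0 : L 0 = 0 by apply: extension0.
have Lsum I (r : seq I) P F : L (\sum_(i <- r | P i) F i) = \sum_(i <- r | P i) L (F i).
  exact: (big_morph _ LD L0).
have lift_symbol i j i' j' m c : modulo N ((c *: 'X_[m] : S) *: E i j i' j')
    (L (c *: 'X_[m] * d1 (quadric e) (E i j i' j'))).
  rewrite d1_symbol // -mul_mpolyC -scalerA mul_mpolyC.
  have XX a b p q : c *: 'X_[m] * (x a b * x p q) = c *: 'X_[cell a b + (cell p q + m)] :> S.
    by rewrite !XD -scalerAl; congr (_ *: _); rewrite mulrC mulrA.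
  case: ifPn => [l|]; last rewrite negb_or => /andP[ni nj].
    rewrite XX LZX; apply: (moduloZ HN).
    exact: (lifting_line (X := fun m => 'X_[m]) (eeS n ee) HN HE four fourT XD
      (z := (i, j)) (w := (i', j')) m l).
  have -> : c *: 'X_[m] * (x i j * x i' j' + e%:MP * (x i j' * x i' j)) =
      c *: 'X_[cell i j + (cell i' j' + m)] +
      (e * c) *: 'X_[cell i j' + (cell i' j + m)] :> S.
    by rewrite mulrDr [_ * (e%:MP * _)]mulrCA !XX mul_mpolyC scalerA.
  rewrite LD !LZX mpolyCM mulrC -scalerA -scalerDr; apply: (moduloZ HN).
  exact: (lifting_edge (X := fun m => 'X_[m]) (eeS n ee) HN HE four fourT XD m ni nj).
(* Since [L] is additive, the congruence passes from the terms c X^m (g) to all of [F1]; on a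
   relation its right-hand side is [L 0]. *)
have liftP v : modulo N v (L (d1 (quadric e) v)).
  have -> : d1 (quadric e) v =
      \sum_q (v : {ffun _ -> _}) q * d1 (quadric e) (basis_symbol k q).
    by apply: eq_bigr => q _; rewrite d1_basis.
  have {1}-> : v = \sum_q (v : {ffun _ -> _}) q *: basis_symbol k q.
    exact: ffun_basis.
  rewrite Lsum; apply: modulo_sum => q _.
  move: ((v : {ffun _ -> S^o}) q) => p; rewrite (mpolyE p) scaler_suml mulr_suml Lsum.
  apply: modulo_sum => m _; rewrite -(symbol_sorted e); exact: lift_symbol.
move=> du; have := liftP u; rewrite (du : d1 _ _ = 0) L0.
by rewrite /modulo subr0.
Qed.

End Generation.

(** * Square-free monomials and permutations *)

Lemma mcoeffMX_lem (R : nzRingType) N (p : {mpoly R[N]}) m M :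
  (p * 'X_[m])@_M = if (m <= M)%MM then p@_(M - m) else 0.
Proof.
case: ifPn => [le|nle]; first by rewrite -{1}(submK le) addmC mcoeffMX.
apply: memN_msupp_eq0; apply: contraNN nle.
rewrite (perm_mem (msuppMX p m)) => /mapP[m' _ ->].
exact: lem_addr.
Qed.

Section PermutationMonomials.

Variable n : nat.
Local Notation mon := 'X_{1..n * n}.

Definition perm_mnm (s : 'S_n) : mon := (\sum_i cell i (s i))%MM.

Lemma rowdeg_perm s i : rowdeg (perm_mnm s) i = 1%N.
Proof.
have -> : rowdeg (perm_mnm s) i = (\sum_i' rowdeg (cell i' (s i')) i)%N.
  apply: (big_morph (fun M => rowdeg M i)) => [M M'|]; first exact: rowdegD.
  by rewrite /rowdeg big1 // => j _; rewrite mnm0E.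
rewrite (bigD1 i) //= rowdeg_cell eqxx big1 // => i' ni.
by rewrite rowdeg_cell (negPf ni).
Qed.

Lemma coldeg_perm s j : coldeg (perm_mnm s) j = 1%N.
Proof.
have -> : coldeg (perm_mnm s) j = (\sum_i' coldeg (cell i' (s i')) j)%N.
  apply: (big_morph (fun M => coldeg M j)) => [M M'|]; first exact: coldegD.
  by rewrite /coldeg big1 // => i _; rewrite mnm0E.
rewrite (bigD1 (s^-1 j)%g) //= coldeg_cell permKV eqxx big1 // => i' ni.
by rewrite coldeg_cell -(inj_eq (@perm_inj _ s^-1)) permK (negPf ni).
Qed.

Lemma sqfree_perm s : sqfree (perm_mnm s).
Proof. by apply/sqfreeP; split=> i; rewrite (rowdeg_perm, coldeg_perm). Qed.

Lemma perm_mnmE s i j : (perm_mnm s (mxvec_index i j) = (s i == j))%N.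
Proof.
rewrite mnm_sumE (bigD1 i) //= mnm1E mxvec_index_eq eqxx big1 ?addn0 // => i' ni.
by rewrite mnm1E mxvec_index_eq (negPf ni).
Qed.

Lemma perm_mnm_inj : injective perm_mnm.
Proof.
move=> s t est; apply/permP=> i; apply/eqP.
have := perm_mnmE t i (s i); rewrite -est perm_mnmE eqxx eq_sym.
by case: eqP.
Qed.

Lemma perm_mnm_tperm s i i' : i != i' ->
  (perm_mnm (tperm i i' * s)%g + (cell i (s i) + cell i' (s i')) =
   perm_mnm s + (cell i (s i') + cell i' (s i)))%MM.
Proof.
move=> ni; have ni' : i' != i by rewrite eq_sym.
rewrite /perm_mnm (bigD1 i) //= (bigD1 i') //= permM tpermL permM tpermR.
rewrite [X in (_ = X + _)%MM](bigD1 i) //=.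
rewrite [X in (_ = _ + X + _)%MM](bigD1 i') //=.
rewrite (eq_bigr (fun t => cell t (s t))) => [|t /andP[nt nt']].
  by move: (\big[_/_]_(_ | _) _) => B; mnm_ac.
by rewrite permM tpermD // eq_sym.
Qed.

Lemma mdeg_rowdeg (M : mon) : mdeg M = (\sum_i rowdeg M i)%N.
Proof.
rewrite /rowdeg pair_bigA mdegE (reindex _ (curry_mxvec_bij _ _)) /=.
by apply: eq_bigr => -[i j] _.
Qed.

Lemma mdeg_coldeg (M : mon) : mdeg M = (\sum_j coldeg M j)%N.
Proof. by rewrite mdeg_rowdeg exchange_big. Qed.

(** An empty row forces degree below n and hence an empty column, so a variable can be added; once
    every row is filled, the monomial is that of a permutation. *)
Lemma sqfree_extend M : sqfree M -> exists s rho, perm_mnm s = (M + rho)%MM.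
Proof.
have [d] := ubnP (n - mdeg M)%N; elim: d M => // d IH M lt_d sqM.
have /sqfreeP[rM cM] := sqM.
have [/forallP full|] := boolP [forall i, (0 < rowdeg M i)%N].
  have rM1 i : rowdeg M i = 1%N by apply/eqP; rewrite eqn_leq rM full.
  have ex i : [exists j, (0 < M (mxvec_index i j))%N].
    have [j [m ->]] := rowdeg_gt0 (full i); apply/existsP; exists j.
    by rewrite mnmDE mnm1E eqxx.
  pose f i := xchoose (existsP (ex i)).
  have fM i : exists m, M = (cell i (f i) + m)%MM.
    exact/mnm_gt0/(xchooseP (existsP (ex i))).
  have f_inj : injective f.
    move=> i i' ef; apply/eqP/contraT => ni.
    have [m EM] := fM i; have [m' EM'] := fM i'.
    move: (EM); rewrite EM' => /(@cell_refine _ (i', f i') (i, f i)).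
    case=> [[[E _]]|[m'' [Em' _]]]; first by rewrite E eqxx in ni.
    by have := cM (f i'); rewrite EM' Em' !degE -ef eqxx.
  exists (perm f_inj), 0%MM; rewrite addm0; apply/mnmP=> t.
  case/mxvec_indexP: t => i j; rewrite perm_mnmE permE.
  have [m EM] := fM i; have := rM1 i; rewrite EM degE rowdeg_cell eqxx => -[rm].
  rewrite mnmDE mnm1E mxvec_index_eq eqxx /=.
  move/eqP: rm; rewrite sum_nat_eq0 => /forallP/(_ j)/eqP ->.
  by rewrite addn0.
rewrite negb_forall => /existsP[i]; rewrite -leqNgt leqn0 => /eqP ri.
have lt_n : (mdeg M < n)%N.
  rewrite mdeg_rowdeg (bigD1 i) //= ri add0n.
  have : (\sum_(i0 | i0 != i) rowdeg M i0 <= \sum_(i0 | i0 != i) 1)%N.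
    by apply: leq_sum => i' _.
  by move/leq_ltn_trans; apply; rewrite sum1_card cardC1 card_ord; case: (n) i {ri} => [[]|].
have [/forallP cfull|] := boolP [forall j, (0 < coldeg M j)%N].
  suff : (n <= mdeg M)%N by rewrite leqNgt lt_n.
  rewrite mdeg_coldeg -[leqLHS](card_ord n) -sum1_card.
  by apply: leq_sum => j _.
rewrite negb_forall => /existsP[j]; rewrite -leqNgt leqn0 => /eqP cj.
have sqM' : sqfree (cell i j + M)%MM.
  apply/sqfreeP; split=> t; rewrite !degE.
    by case: eqP => [<-|_]; rewrite ?ri ?rM.
  by case: eqP => [<-|_]; rewrite ?cj ?cM.
have [|s [rho Es]] := IH _ _ sqM'.
  by rewrite mdegD mdeg1; move: lt_d lt_n; clear; lia.
by exists s, (cell i j + rho)%MM; rewrite Es addmA [(M + _)%MM]addmC.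
Qed.

Definition same_type (M M' : mon) : bool :=
  [forall i, rowdeg M i == rowdeg M' i] && [forall j, coldeg M j == coldeg M' j].

Lemma same_typeP M M' :
  reflect (rowdeg M =1 rowdeg M' /\ coldeg M =1 coldeg M') (same_type M M').
Proof.
apply: (iffP andP) => -[h1 h2]; split.
- by move=> i; apply/eqP/(forallP h1).
- by move=> i; apply/eqP/(forallP h2).
- by apply/forallP=> i; rewrite h1.
- by apply/forallP=> i; rewrite h2.
Qed.

Lemma same_type_refl M : same_type M M.
Proof. by apply/same_typeP. Qed.

Lemma same_type_trans M M' M'' :
  same_type M M' -> same_type M M'' = same_type M' M''.
Proof.
move=> /same_typeP[h1 h2].
by congr (_ && _); apply: eq_forallb => i; rewrite (h1, h2).
Qed.

Lemma same_typeC M M' : same_type M M' = same_type M' M.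
Proof. by congr (_ && _); apply: eq_forallb => i; rewrite eq_sym. Qed.

(** [choose] depends only on the class as a predicate, which makes this a canonical representative
    ([eq_type_rep]). *)
Definition type_rep (M : mon) : mon := choose (same_type M) M.

Lemma type_repP M : same_type M (type_rep M).
Proof. exact: chooseP (same_type_refl M). Qed.

Lemma eq_type_rep M M' : same_type M M' -> type_rep M = type_rep M'.
Proof.
move=> h; rewrite /type_rep (eq_choose (fun M'' => same_type_trans M'' h)).
by apply: choose_id; rewrite ?same_type_refl // same_typeC.
Qed.

Lemma sqfree_same_type M M' : same_type M M' -> sqfree M = sqfree M'.
Proof. by move=> /same_typeP[h1 h2]; apply: eq_sqfree. Qed.

End PermutationMonomials.

(** * The apolar ideal of an immanant *)

Section Apolarity.

Variables (k : fieldType) (n : nat) (e : k).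
Hypothesis ee : e * e = 1.
Local Notation S := {mpoly k[n * n]}.
Local Notation mon := 'X_{1..n * n}.
Local Notation x := (@mxvar k n).

(* The determinant for e = 1, the permanent for e = -1. *)
Definition immanant : S := \sum_(s : 'S_n) (- e) ^+ s *: 'X_[perm_mnm s].

(** The coefficient at [rho] of the contraction of the immanant by [g]; apolarity becomes the
    vanishing of these linear functionals. *)
Definition pairing (rho : mon) (g : S) : k :=
  \sum_(s : 'S_n | (rho <= perm_mnm s)%MM) (- e) ^+ s * g@_(perm_mnm s - rho).

Lemma contract_pairing g rho : (contract g immanant)@_rho = pairing rho g.
Proof.
pose f (m' : mon) (c : k) := if (rho <= m')%MM then c * g@_(m' - rho) else 0.
have fD m' : {morph f m' : a b / a + b}.
  by move=> a b; rewrite /f; case: ifP; rewrite ?mulrDl ?addr0.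
have -> : (contract g immanant)@_rho = extension f immanant.
  rewrite /contract raddf_sum /=.
  under eq_bigr => m _ do rewrite raddf_sum /=.
  rewrite (exchange_big_dep xpredT) //=; apply: eq_bigr => m' _.
  rewrite /f; under eq_bigr => m _ do rewrite mcoeffZ mcoeffX.
  case: ifPn => [le|nle].
    have [msup|nsup] := boolP (m' - rho \in msupp g)%MM; last first.
      rewrite (memN_msupp_eq0 nsup) mulr0 big_seq_cond big1 // => m /andP[ms le'].
      case: eqP => [E|_]; last by rewrite mulr0.
      by case/negP: nsup; rewrite -E submBA // addmC addmK.
    rewrite big_mkcond (bigD1_seq (m' - rho)%MM) ?msupp_uniq //= lem_subr.
    rewrite submBA // addmC addmK eqxx mulr1 mulrC.
    rewrite big1 ?addr0 // => m ne; case: ifP => // le'.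
    case: eqP => [E|_]; last by rewrite mulr0.
    by case/eqP: ne; rewrite -E submBA // addmC addmK.
  rewrite big1 // => m le'; case: eqP => [E|_]; last by rewrite mulr0.
  by case/negP: nle; rewrite -E lem_subr.
rewrite extension_sum //; under eq_bigr do rewrite extensionZX //.
by rewrite /pairing [RHS]big_mkcond; apply: eq_bigr.
Qed.

Lemma apolarP g : apolar immanant g <-> forall rho, pairing rho g = 0.
Proof.
rewrite /apolar; split=> [h rho|h]; first by rewrite -contract_pairing h mcoeff0.
by apply/mpolyP => rho; rewrite contract_pairing mcoeff0.
Qed.

Lemma pairing_is_linear rho : linear (pairing rho : S -> k^o).
Proof.
move=> a p q; rewrite /pairing scaler_sumr -big_split; apply: eq_bigr => s _ /=.
by rewrite mcoeffD mcoeffZ mulrDr [_ * (a * _)]mulrCA.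
Qed.

HB.instance Definition _ rho :=
  GRing.isLinear.Build k S k^o _ (pairing rho) (pairing_is_linear rho).

Lemma pairingMX rho g m : pairing rho (g * 'X_[m]) = pairing (rho + m)%MM g.
Proof.
rewrite /pairing [LHS]big_mkcond [RHS]big_mkcond; apply: eq_bigr => s _ /=.
rewrite mcoeffMX_lem; have [le|nle] := boolP (rho <= perm_mnm s)%MM.
  have -> : (m <= perm_mnm s - rho)%MM = (rho + m <= perm_mnm s)%MM.
    apply/mnm_lepP/mnm_lepP => h t; have := h t; have := mnm_lepP le t;
      rewrite mnmBE mnmDE; lia.
  by case: ifP; rewrite ?mulr0 // submDA.
case: ifPn => // le; case/negP: nle.
exact: lepm_trans (lem_addr _ _) le.
Qed.

Lemma pairingX rho M :
  pairing rho 'X_[M] = \sum_(s : 'S_n | perm_mnm s == (rho + M)%MM) (- e) ^+ s.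
Proof.
rewrite /pairing [LHS]big_mkcond [RHS]big_mkcond; apply: eq_bigr => s _ /=.
rewrite mcoeffX; case: ifPn => [le|nle].
  have -> : (perm_mnm s == rho + M)%MM = (M == perm_mnm s - rho)%MM.
    by rewrite -{1}(submK le) addmC eqm_add2l eq_sym.
  by case: eqP; rewrite ?mulr1 ?mulr0.
by case: eqP => // E; rewrite E lem_addr in nle.
Qed.

(** Two cells on a line divide no permutation monomial. For a two-term quadric, composing with the
    transposition of the two rows matches the permutations counted by the two terms and changes the
    weight by -e, and e(-e) = -1. *)
Lemma pairing_quadric rho q : pairing rho (quadric e q) = 0.
Proof.
have line0 z w : line z w -> pairing rho (x z.1 z.2 * x w.1 w.2) = 0.
  move=> l; have -> : x z.1 z.2 * x w.1 w.2 = 'X_[cell z.1 z.2 + cell w.1 w.2] :> S.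
    by rewrite mpolyXD.
  rewrite pairingX big1 // => s /eqP E.
  have := sqfree_perm s; rewrite E => /sqfreeDl.
  by rewrite -[cell w.1 w.2]addm0 (negPf (line_nsqfree _ l)).
rewrite -(d1_basis (quadric e)) -(symbol_sorted e q) d1_symbol //.
case: ifPn => [l|]; first exact: (line0 (_, _) (_, _)).
move: (val q.1).1 (val q.2).1 (val q.1).2 (val q.2).2 => i j i' j'.
rewrite negb_or => /andP[ni nj].
have XX a b c d : x a b * x c d = 'X_[cell a b + cell c d] :> S.
  by rewrite mpolyXD.
rewrite mul_mpolyC linearD linearZ /= !XX !pairingX.
rewrite [X in _ + _ * X](reindex_inj (mulgI (tperm i i'))) /=.
rewrite [X in _ + _ * X](eq_bigl (fun s => perm_mnm s == rho + (cell i j + cell i' j'))%MM).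
  rewrite mulr_sumr -big_split big1 //= => s _.
  rewrite odd_permM odd_tperm ni /=.
  have sgnN : (- e) ^+ (~~ odd_perm s) = (- e) * (- e) ^+ odd_perm s.
    by case: (odd_perm s); rewrite ?expr0 ?expr1 ?mulr1 // mulrNN ee.
  by rewrite sgnN mulrA mulrN ee mulN1r subrr.
move=> s; have cells u a b c d : perm_mnm u = (rho + (cell a b + cell c d))%MM ->
    u a = b /\ u c = d.
  move=> E; split; apply/eqP; rewrite -[_ == _]lt0b -perm_mnmE E !mnmDE !mnm1E.
    by rewrite eqxx !addnA addnAC addn1.
  by rewrite eqxx !addnA addn1.
have swap := perm_mnm_tperm s ni.
apply/eqP/eqP => E.
  case: (cells _ _ _ _ _ E); rewrite !permM tpermL tpermR => si' si.
  apply: (@addIm _ (cell i j' + cell i' j)%MM).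
  by rewrite -{1}si' -{1}si -swap E si si'; mnm_ac.
case: (cells _ _ _ _ _ E) => si si'.
apply: (@addIm _ (cell i j + cell i' j')%MM).
by rewrite -{1}si -{1}si' swap E si si'; mnm_ac.
Qed.

Lemma apolar_d1 u : apolar immanant (d1 (quadric e) u).
Proof.
apply/apolarP => rho; rewrite /d1 raddf_sum big1 //= => q _.
move: ((u : {ffun _ -> S^o}) q : S) => p.
rewrite (mpolyE p) scaler_suml raddf_sum big1 //= => m _.
have -> : (p@_m *: 'X_[m]) *: quadric e q = p@_m *: ('X_[m] * (quadric e q : S)) :> S.
  exact/esym/scalerAl.
by rewrite linearZ /= mulrC pairingMX pairing_quadric scaler0.
Qed.

Lemma apolarB g h : apolar immanant g -> apolar immanant h ->
  apolar immanant (g - h : S).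
Proof.
move=> /apolarP hg /apolarP hh; apply/apolarP => rho.
by rewrite linearB /= hg hh subrr.
Qed.

(** Complete a monomial M of [h] to a permutation monomial by [rho]. The functional [pairing rho]
    sees only monomials of the multidegree of M, and M is the only representative there, so its
    coefficient vanishes. *)
Lemma reps_independent (h : S) : apolar immanant h ->
  (forall M, h@_M != 0 -> sqfree M /\ type_rep M = M) -> h = 0.
Proof.
move=> /apolarP ap rep; apply/mpolyP => M; rewrite mcoeff0; apply/eqP.
apply: contraTT isT => nM; have [sqM repM] := rep M nM.
have [s [rho Es]] := sqfree_extend sqM.
have := ap rho; rewrite /pairing (bigD1 s) ?Es ?lem_addl //= addmK big1.
  rewrite addr0 => /eqP; rewrite mulf_eq0 (negPf nM) orbF expf_eq0 => /andP[_].
  rewrite oppr_eq0 => /eqP e0; have := ee; rewrite e0 mul0r => /esym/eqP.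
  by rewrite oner_eq0.
move=> s' /andP[le ns]; have [->|nz] := eqVneq h@_(perm_mnm s' - rho) 0.
  by rewrite mulr0.
have [sqM' repM'] := rep _ nz; case/negP: ns; apply/eqP/perm_mnm_inj.
rewrite Es -(submK le); congr (_ + _)%MM.
rewrite -repM -repM'; apply: eq_type_rep; apply/same_typeP; split=> t.
  have : rowdeg (perm_mnm s') t = rowdeg (perm_mnm s) t by rewrite !rowdeg_perm.
  by rewrite -{1}(submK le) Es !rowdegD => /addIn.
have : coldeg (perm_mnm s') t = coldeg (perm_mnm s) t by rewrite !coldeg_perm.
by rewrite -{1}(submK le) Es !coldegD => /addIn.
Qed.

Lemma monomial_line (z w : 'I_n * 'I_n) m : line z w ->
  'X_[cell z.1 z.2 + (cell w.1 w.2 + m)] =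
  d1 (quadric e) (('X_[m] : S) *: symbol e z.1 z.2 w.1 w.2).
Proof.
move=> l; rewrite d1Z d1_symbol // -/(line z w) l.
by rewrite addmA addmC !mpolyXD.
Qed.

Lemma monomial_edge (j a k' b : 'I_n) m : j != k' -> a != b ->
  'X_[cell j a + (cell k' b + m)] =
  - e *: 'X_[cell j b + (cell k' a + m)] +
  d1 (quadric e) (('X_[m] : S) *: symbol e j a k' b) :> S.
Proof.
move=> nj na; rewrite d1Z d1_symbol // (negPf nj) (negPf na) /=.
rewrite mulrDr [_ * (e%:MP * _)]mulrCA mul_mpolyC.
have XX i1 j1 i2 j2 : 'X_[m] * (x i1 j1 * x i2 j2) =
    'X_[cell i1 j1 + (cell i2 j2 + m)] :> S.
  by rewrite addmA addmC !mpolyXD.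
by rewrite !XX addrC -addrA -scalerDl addrN scale0r addr0.
Qed.

(** Any variable of M' is either present in M or brought into it by one edge; dividing by it lowers
    the degree. The scalar is a sign, but only its existence matters. *)
Lemma sqfree_reduce M M' : sqfree M -> same_type M M' ->
  exists a (u : F1 k n), 'X_[M] = a *: 'X_[M'] + d1 (quadric e) u :> S.
Proof.
have [d] := ubnP (mdeg M); elim: d M M' => // d IH M M' lt_d sqM /same_typeP[rM cM].
have [M'0|nM'] := eqVneq M' 0%MM.
  exists 1, 0; rewrite scale1r /d1 big1 ?addr0 => [|q _].
    suff -> : M = 0%MM by rewrite M'0.
    apply/eqP; rewrite -mdeg_eq0 mdeg_rowdeg big1 // => i _.
    by rewrite rM M'0 /rowdeg big1 // => j _; rewrite mnm0E.
  by rewrite ffunE scale0r.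
have [i [j [m' EM']]] := mnm_neq0 nM'.
have [|c [m EM]] := @rowdeg_gt0 n M i; first by rewrite rM EM' !degE eqxx.
have step m1 : (mdeg m1 < d)%N -> sqfree m1 ->
    (forall t, rowdeg (cell i j + m1)%MM t = rowdeg M' t) ->
    (forall t, coldeg (cell i j + m1)%MM t = coldeg M' t) ->
    exists a (u : F1 k n), 'X_[cell i j + m1] = a *: 'X_[M'] + d1 (quadric e) u :> S.
  move=> lt1 sq1 r1 c1; have [|a [u Eu]] := IH m1 m' lt1 sq1.
    apply/same_typeP; split=> t.
      by have := r1 t; rewrite EM' !rowdegD => /addnI.
    by have := c1 t; rewrite EM' !coldegD => /addnI.
  exists a, (x i j *: u); rewrite d1Z EM' !mpolyXD Eu mulrDr.
  by rewrite -scalerAr.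
have [Ec|nc] := eqVneq c j.
  rewrite Ec in EM; rewrite EM; apply: step.
  - by move: lt_d; rewrite EM mdegD mdeg1.
  - by move: sqM; rewrite EM => /sqfreeDl.
  - by move=> t; rewrite -EM rM.
  - by move=> t; rewrite -EM cM.
have [|r [m2 EM2]] := @coldeg_gt0 n M j; first by rewrite cM EM' !degE eqxx.
move: (EM); rewrite {1}EM2 => /(@cell_refine _ (r, j) (i, c)).
case=> [[[_ E]]|[m3 [_ Em]]]; first by rewrite E eqxx in nc.
rewrite Em in EM; have [nir _] := sqfree_neq sqM EM.
have [||||a [u Eu]] := step (cell r c + m3)%MM.
- by move: lt_d; rewrite EM !mdegD !mdeg1.
- apply/sqfreeP; case/sqfreeP: sqM => h1 h2; rewrite EM in h1 h2.
  split=> t; [apply: leq_trans (h1 t)|apply: leq_trans (h2 t)].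
    by rewrite !degE leq_addl.
  by rewrite !degE leq_add2l leq_addl.
- by move=> t; rewrite -rM EM !degE.
- by move=> t; rewrite -cM EM !degE addnCA.
exists (- e * a), (- e%:MP *: u + ('X_[m3] : S) *: symbol e i c r j).
rewrite EM (monomial_edge m3 nir nc) Eu d1D d1Z scalerDr scalerA -addrA.
by congr (_ + (_ + _)); rewrite d1Z mulNr mul_mpolyC scaleNr.
Qed.

Lemma quadric_normal_form (g : S) :
  exists (u : F1 k n) (h : S), g = h + d1 (quadric e) u /\
    forall M, h@_M != 0 -> sqfree M /\ type_rep M = M.
Proof.
have mono M : exists (u : F1 k n) (a : k),
    'X_[M] = (if sqfree M then a *: 'X_[type_rep M] else 0) + d1 (quadric e) u :> S.
  have [sqM|/nsqfreeP[z [w [m [l ->]]]]] := boolP (sqfree M).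
    by have [a [u ->]] := sqfree_reduce sqM (type_repP M); exists u, a.
  by exists (('X_[m] : S) *: symbol e z.1 z.2 w.1 w.2), 0; rewrite add0r monomial_line.
rewrite (mpolyE g); elim: (msupp g) => [|M r [u [h [E hrep]]]].
  exists 0, 0; split=> [|M]; last by rewrite mcoeff0 eqxx.
  by rewrite big_nil add0r /d1 big1 // => q _; rewrite ffunE scale0r.
have [v [a EM]] := mono M; rewrite big_cons E EM.
exists ((g@_M)%:MP *: v + u).
exists ((if sqfree M then (g@_M * a) *: 'X_[type_rep M] else 0) + h); split.
  rewrite d1D d1Z mul_mpolyC scalerDr addrACA; congr (_ + _ + _).
  by case: ifP; rewrite ?scaler0 // scalerA.
move=> M'; rewrite mcoeffD; have [->|nz _] := eqVneq h@_M' 0; last exact: hrep.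
case: ifP => [sqM|_]; last by rewrite mcoeff0 addr0 eqxx.
rewrite addr0 mcoeffZ mcoeffX; case: (type_rep M =P M') => [<- _|_]; last first.
  by rewrite mulr0 eqxx.
rewrite -(sqfree_same_type (type_repP M)) sqM; split=> //.
by apply/esym/eq_type_rep/type_repP.
Qed.

Lemma quadrics_span g : apolar immanant g ->
  exists u : F1 k n, g = d1 (quadric e) u.
Proof.
move=> ap; have [u [h [Eg hrep]]] := quadric_normal_form g.
exists u; suff h0 : h = 0 by rewrite Eg h0 add0r.
apply: reps_independent hrep.
have -> : h = g - d1 (quadric e) u by rewrite Eg addrK.
by apply: apolarB => //; apply: apolar_d1.
Qed.

(** Since the index pairs are sorted, distinct quadrics have distinct leads and the second term of a
    quadric is never a lead; the coefficient at [lead q] therefore isolates one quadric. *)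
Definition lead (q : quad_index n) : mon :=
  (cell (val q.1).1 (val q.2).1 + cell (val q.1).2 (val q.2).2)%MM.

Definition trail (q : quad_index n) : mon :=
  (cell (val q.1).1 (val q.2).2 + cell (val q.1).2 (val q.2).1)%MM.

Lemma cell2_inj (i j i' j' p r p' r' : 'I_n) :
  (cell i j + cell i' j' = cell p r + cell p' r')%MM ->
  [/\ i = p, j = r, i' = p' & j' = r'] \/ [/\ i = p', j = r', i' = p & j' = r].
Proof.
move=> E; have : (cell i j + (cell i' j' + 0) = cell p r + (cell p' r' + 0))%MM.
  by rewrite !addm0.
case/(@cell_refine _ (i, j) (p, r)) => [[[-> ->]]|[m []]].
  by case/(@cell_refine _ (i', j') (p', r')) => [[[-> ->]]|[? [/esym/eqP]]];
    [left|rewrite mnmD_eq0 mnm1_eq0].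
case/(@cell_refine _ (i', j') (p, r)) => [[[-> ->] <-]|[? [/esym/eqP]]]; last first.
  by rewrite mnmD_eq0 mnm1_eq0.
case/(@cell_refine _ (p', r') (i, j)) => [[[-> ->]]|[? [/esym/eqP]]]; first by right.
by rewrite mnmD_eq0 mnm1_eq0.
Qed.

Lemma lead_inj : injective lead.
Proof.
move=> [[[i i'] /= hi] [[j j'] /= hj]] [[[p p'] /= hp] [[r r'] /= hr]].
case/cell2_inj => /= -[Ei Ej Ei' Ej']; subst.
  by congr (_, _); apply: val_inj.
have Ep : p = p' by apply/val_inj/anti_leq; rewrite hp.
have Er : r = r' by apply/val_inj/anti_leq; rewrite hr.
by subst; congr (_, _); apply: val_inj.
Qed.

Lemma trail_neq_lead q q' : (val q.1).1 != (val q.1).2 ->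
  (val q.2).1 != (val q.2).2 -> trail q != lead q'.
Proof.
case: q q' => [[[i i'] /= hi] [[j j'] /= hj]] [[[p p'] /= hp] [[r r'] /= hr]].
move=> ni nj; apply/eqP => /cell2_inj /= [] [Ei Ej Ei' Ej']; subst.
  by case/negP: nj; apply/eqP/val_inj/anti_leq; rewrite hj.
by case/negP: ni; apply/eqP/val_inj/anti_leq; rewrite hi.
Qed.

Lemma quadricE q : quadric e q =
  'X_[lead q] + (if (val q.1).1 != (val q.1).2 then
                 if (val q.2).1 != (val q.2).2 then e *: 'X_[trail q] else 0 else 0) :> S.
Proof.
rewrite /quadric /lead /trail !mpolyXD.
by case: (val q.1) (val q.2) => [i i'] [j j'] /=; do 2?case: eqP; rewrite ?addr0.
Qed.

Lemma quadric_homog q : (quadric e q : S) \is 2.-homog.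
Proof.
rewrite quadricE rpredD // ?dhomogX /= ?mdegD ?mdeg1 //.
do 2?case: ifP => _; rewrite ?rpred0 // rpredZ // dhomogX /= mdegD !mdeg1 //.
Qed.

Lemma mcoeffM_lead (p : S) q q' :
  (p * quadric e q)@_(lead q') = p@_0%MM * (q == q')%:R.
Proof.
have mono (M : mon) : mdeg M = 2%N -> (p * 'X_[M])@_(lead q') = p@_0%MM * (M == lead q')%:R.
  move=> dM; rewrite mcoeffMX_lem; case: eqP => [->|ne].
    by rewrite lepm_refl -[X in (X - _)%MM]add0m addmK mulr1.
  case: ifP => [le|_]; last by rewrite mulr0.
  case: ne; rewrite -(submK le); suff -> : (lead q' - M = 0)%MM by rewrite add0m.
  apply/eqP; rewrite -mdeg_eq0; apply/eqP.
  have : mdeg (lead q' - M + M) = 2%N by rewrite submK // mdegD !mdeg1.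
  by rewrite mdegD dM; case: (mdeg _) => // d; rewrite !addnS.
rewrite quadricE mulrDr mcoeffD mono ?mdegD ?mdeg1 // (inj_eq lead_inj).
case: ifP => ni; last by rewrite mulr0 mcoeff0 addr0.
case: ifP => nj; last by rewrite mulr0 mcoeff0 addr0.
rewrite -scalerAr mcoeffZ mono ?mdegD ?mdeg1 //.
by rewrite (negPf (trail_neq_lead _ ni nj)) !mulr0 addr0.
Qed.

Lemma quadrics_generate :
  minimally_generates (quadric e : quad_index n -> S^o) (apolar immanant).
Proof.
have ap q : apolar immanant (quadric e q).
  by have := apolar_d1 (basis_symbol k q); rewrite d1_basis.
split=> [|A /properP[_ [q0 _ q0A]] [_ gen]].
  split=> [q _|g /quadrics_span[u ->]]; first exact: ap.
  by exists (u : {ffun _ -> _}); apply: eq_bigl => q; rewrite inE.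
have [c Ec] := gen _ (ap q0).
have : (quadric e q0 : S)@_(lead q0) = (\sum_(q in A) c q * quadric e q : S)@_(lead q0).
  by rewrite {1}Ec.
rewrite -[quadric e q0 : S]mul1r mcoeffM_lead mcoeff1 !eqxx mulr1 raddf_sum big1 /=.
  by move/eqP; rewrite oner_eq0.
move=> q qA; rewrite mcoeffM_lead; case: eqP => [E|_]; last by rewrite mulr0.
by rewrite E (negPf q0A) in qA.
Qed.

End Apolarity.

(** * Linear relations of a space of quadrics *)

Section Components.

Variables (k : fieldType) (N : nat).

Lemma pihomogM d d' (p q : {mpoly k[N]}) : q \is d'.-homog ->
  pihomog mdeg (d + d') (p * q) = pihomog mdeg d p * q.
Proof.
move=> hq; rewrite {1 2}(mpolyE p) mulr_suml !raddf_sum mulr_suml /=.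
apply: eq_bigr => m _; rewrite -scalerAl !linearZ -scalerAl /=; congr (_ *: _).
have hXq : 'X_[m] * q \is (mdeg m + d').-homog.
  by apply: dhomogM => //; rewrite dhomogX.
rewrite pihomogX; have [<-|ne] := eqVneq; first by rewrite pihomog_dE.
by rewrite mul0r (pihomog_ne0 _ hXq) // eqn_add2r.
Qed.

Lemma mcoeff_pihomog d (p : {mpoly k[N]}) M :
  (pihomog mdeg d p)@_M = if mdeg M == d then p@_M else 0.
Proof.
pose b := maxn (msize p) (mdeg M).+1.
rewrite (@pihomogwE _ _ _ _ b) ?leq_maxl // big_mkcond /=.
pose E m := if mdeg m == d then p@_m else 0.
rewrite (eq_bigr (fun m : 'X_{1..N < b} => E m *: 'X_[m])); last first.
  by move=> m _; rewrite /E; case: ifP => // _; rewrite scale0r.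
by rewrite mcoeff_mpoly // leq_max leqnn orbT.
Qed.

Variable reduced : pred 'X_{1..N}.
Definition cubics : {set 'X_{1..N < 4}} :=
  [set b : 'X_{1..N < 4} | (mdeg b == 3%N) && reduced b].

End Components.

Section LinearSyzygies.

Variables (k : fieldType) (N : nat) (Q : finType) (g : Q -> {mpoly k[N.+1]}).
Hypothesis g_homog : forall q, g q \is 2.-homog.
Variable reduced : pred 'X_{1..N.+1}.
Hypothesis normal_form : forall p, exists (u : Q -> {mpoly k[N.+1]}) h,
  p = h + \sum_q u q * g q /\ forall M, h@_M != 0 -> reduced M.
Hypothesis reduced_indep : forall (u : Q -> {mpoly k[N.+1]}) h,
  h = \sum_q u q * g q -> (forall M, h@_M != 0 -> reduced M) -> h = 0.

Local Notation V1 := {ffun Q -> dhomog N.+1 k 1}.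
Local Notation V3 := (dhomog N.+1 k 3).

Let D (u : V1) : V3 := indhomog 3 (\sum_q mpoly_of_dhomog (u q) * g q).

Let val_D u : mpoly_of_dhomog (D u) = \sum_q mpoly_of_dhomog (u q) * g q.
Proof.
have hD : \sum_q mpoly_of_dhomog (u q) * g q \is 3.-homog.
  apply: rpred_sum => q _; apply: (dhomogM (d := 1) (e := 2)) => //.
  exact: dhomog_is_dhomog.
by rewrite /D /indhomog insubdK.
Qed.

Let D_linear : linear D.
Proof.
move=> a u v; apply: val_inj; rewrite linearP /= !val_D scaler_sumr -big_split.
by apply: eq_bigr => q _; rewrite !ffunE linearP /= mulrDl scalerAl.
Qed.

HB.instance Definition _ := GRing.isLinear.Build k V1 V3 _ D D_linear.

Let XB : seq V3 := [seq indhomog 3 'X_[b] | b : 'X_{1..N.+1 < 4} <- enum (cubics reduced)].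

(** The reduced cubics span a complement of the image of [D] in degree three: [normal_form] gives
    the sum and [reduced_indep] the trivial intersection. This determines the rank, and the kernel
    has the remaining dimension. *)
Lemma dim_linear_syzygies :
  \dim (lker (linfun D)) = (#|Q| * N.+1 - ('C(N + 3, 3) - #|cubics reduced|))%N.
Proof.
have valX b : b \in cubics reduced -> mpoly_of_dhomog (indhomog 3 'X_[b] : V3) = 'X_[b].
  rewrite inE => /andP[/eqP db _]; rewrite /indhomog insubdK //.
  have : ('X_[b] : {mpoly k[N.+1]}) \is 3.-homog by rewrite dhomogX /= db.
  by [].
have valZ c (p : V3) : mpoly_of_dhomog (c *: p) = c *: mpoly_of_dhomog p by [].
have sizeXB : size XB = #|cubics reduced| by rewrite size_map cardE.
pose b_ i := nth bm0 (enum (cubics reduced)) i.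
have b_in (i : 'I_(size XB)) : b_ i \in cubics reduced.
  by rewrite -mem_enum mem_nth // -cardE -sizeXB.
have XB_nth (i : 'I_(size XB)) : XB`_i = indhomog 3 'X_[b_ i].
  by rewrite (nth_map bm0) // -cardE -sizeXB.
have coefXB (c : 'I_(size XB) -> k) (M : 'X_{1..N.+1}) :
    (mpoly_of_dhomog (\sum_i c i *: XB`_i))@_M = \sum_i c i * (b_ i == M :> 'X_{1..N.+1})%:R.
  rewrite linear_sum raddf_sum /=; apply: eq_bigr => i _.
  apply: (etrans (congr1 (mcoeff M) (valZ _ _))).
  by rewrite mcoeffZ XB_nth valX // mcoeffX.
have redXB (c : 'I_(size XB) -> k) (M : 'X_{1..N.+1}) :
    (mpoly_of_dhomog (\sum_i c i *: XB`_i))@_M != 0 -> reduced M.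
  rewrite coefXB => nz.
  have /existsP[i] : [exists i : 'I_(size XB), b_ i == M :> 'X_{1..N.+1}].
    apply: contraNT nz; rewrite negb_exists => /forallP h.
    by rewrite big1 // => i _; rewrite (negPf (h i)) mulr0.
  by move/eqP <-; have := b_in i; rewrite inE => /andP[].
have freeXB : free XB.
  apply/(@freeP _ _ _ (in_tuple XB)) => c c0 i.
  have := coefXB c (b_ i); rewrite c0 mcoeff0 (bigD1 i) //= eqxx mulr1 big1.
    by rewrite addr0.
  move=> j ne; rewrite -bmeqP nth_uniq ?enum_uniq -?cardE -?sizeXB //.
  by rewrite (inj_eq val_inj) (negPf ne) mulr0.
have sumXB (h : V3) : (forall M, (mpoly_of_dhomog h)@_M != 0 -> reduced M) -> h \in <<XB>>%VS.
  move=> red; have -> : h = \sum_(b in cubics reduced) (mpoly_of_dhomog h)@_b *: indhomog 3 'X_[b].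
    have h3 : mpoly_of_dhomog h \is 3.-homog by apply: dhomog_is_dhomog.
    apply: val_inj; rewrite linear_sum /= {1}(@mpolywE _ _ 4 (mpoly_of_dhomog h)); last first.
      rewrite msizeE; apply/bigmax_leqP_seq => M MS _.
      by rewrite (dhomog_mf h3 MS).
    rewrite [LHS](bigID (mem (cubics reduced))) /= [X in _ + X]big1 ?addr0.
      by apply: eq_bigr => b bB; apply: esym; apply: (etrans (valZ _ _)); rewrite valX.
    move=> b; rewrite inE negb_and => nb; apply/eqP; rewrite scaler_eq0.
    apply/orP; left; case/orP: nb => [nb|]; last by apply: contraNT => /red.
    by rewrite (dhomog_nemf_coeff h3).
  apply: rpred_sum => b bB; apply/rpredZ/memv_span/map_f.
  by rewrite mem_enum.
have capXB : (limg (linfun D) :&: <<XB>> = 0)%VS.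
  apply/eqP; rewrite -subv0; apply/subvP => h; rewrite memv_cap memv0.
  case/andP => /memv_imgP[u _ Eh] /(@coord_span _ _ _ (in_tuple XB)) /= hX.
  apply/eqP/val_inj/(@reduced_indep (fun q => mpoly_of_dhomog (u q))).
    by rewrite Eh lfunE; apply: val_D.
  by move=> M; rewrite hX; apply: redXB.
have addXB : (limg (linfun D) + <<XB>> = fullv)%VS.
  apply/eqP; rewrite eqEsubv subvf; apply/subvP => p _.
  have [u [h [Ep hred]]] := normal_form (mpoly_of_dhomog p).
  have hp : mpoly_of_dhomog p \is 3.-homog by apply: dhomog_is_dhomog.
  (* The normal form need not be homogeneous; its components of degrees one and three already
     represent the cubic [p]. *)
  pose v : V1 := [ffun q => DHomog (pihomogP mdeg 1 (u q))].
  pose h3 : V3 := DHomog (pihomogP mdeg 3 h).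
  have -> : p = linfun D v + h3.
    apply: val_inj; rewrite linearD /= lfunE val_D /= addrC.
    rewrite -{1}(pihomog_dE hp) {1}Ep raddfD raddf_sum /=; congr (_ + _).
    by apply: eq_bigr => q _; rewrite ffunE /= (pihomogM 1 _ (g_homog q)).
  apply: memv_add; first exact/memv_img/memvf.
  apply: sumXB => M /=; rewrite mcoeff_pihomog.
  by case: ifP => _; [apply: hred|rewrite eqxx].
have := dimv_disjoint_sum capXB; rewrite addXB dimvf (eqnP freeXB) sizeXB.
have := limg_ker_dim (linfun D) fullv; rewrite capfv !dimvf.
have -> : dim V1 = (#|Q| * 'C(1 + N, 1))%N by [].
rewrite bin1 add1n.
have -> : dim V3 = 'C(3 + N, 3) by [].
by rewrite [(N + 3)%N]addnC; lia.
Qed.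

Lemma linear_syzygy_basis_succ (m : nat) :
  m = (#|Q| * N.+1 - ('C(N + 3, 3) - #|cubics reduced|))%N ->
  exists r : 'I_m -> {ffun Q -> {mpoly k[N.+1]}^o},
  [/\ forall t q, (r t q : {mpoly k[N.+1]}) \is 1.-homog,
      forall t, \sum_q (r t q : {mpoly k[N.+1]}) * g q = 0,
      forall u : {ffun Q -> {mpoly k[N.+1]}^o},
        (forall q, (u q : {mpoly k[N.+1]}) \is 1.-homog) ->
        \sum_q (u q : {mpoly k[N.+1]}) * g q = 0 ->
        exists c : 'I_m -> k, u = \sum_t ((c t)%:MP : {mpoly k[N.+1]}) *: r t
    & forall c : 'I_m -> k,
        \sum_t ((c t)%:MP : {mpoly k[N.+1]}) *: r t = 0 -> forall t, c t = 0].
Proof.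
rewrite -dim_linear_syzygies => ->.
pose K := lker (linfun D); pose b := vbasis K.
pose r (t : 'I_(\dim K)) : {ffun Q -> {mpoly k[N.+1]}^o} :=
  [ffun q => mpoly_of_dhomog (b`_t q)].
have rsum (c : 'I_(\dim K) -> k) q : (\sum_t ((c t)%:MP : {mpoly k[N.+1]}) *: r t) q =
    mpoly_of_dhomog ((\sum_t c t *: b`_t) q).
  rewrite !sum_ffunE linear_sum; apply: eq_bigr => t _ /=.
  by rewrite !ffunE; apply: mul_mpolyC.
exists r; split.
- by move=> t q; rewrite ffunE; apply: dhomog_is_dhomog.
- move=> t; have : b`_t \in K by apply: vbasis_mem; rewrite mem_nth ?size_tuple.
  rewrite memv_ker lfunE => /eqP Db; apply: (etrans _ (congr1 val Db)).
  apply: (etrans _ (esym (val_D _))).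
  by apply: eq_bigr => q _; rewrite ffunE.
- move=> u hu du; pose v : V1 := [ffun q => DHomog (hu q)].
  have vK : v \in K.
    rewrite memv_ker lfunE; apply/eqP/val_inj.
    apply: (etrans (val_D v)); rewrite -[RHS]du.
    by apply: eq_bigr => q _; rewrite ffunE.
  exists (coord b ^~ v); apply/ffunP => q; rewrite rsum.
  by rewrite -(coord_vbasis vK) ffunE.
- move=> c c0; apply: (freeP (basis_free (vbasisP K))).
  apply/ffunP => q; apply: val_inj; apply: (etrans (esym (rsum c q))).
  by rewrite c0 !ffunE.
Qed.

End LinearSyzygies.

(* The hypotheses say that the reduced monomials represent a basis of S modulo the
   g q, whence the dimension of the linear syzygies by rank-nullity in degree 3. *)
Lemma linear_syzygy_basis (k : fieldType) (N : nat) (Q : finType)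
    (g : Q -> {mpoly k[N]}) (reduced : pred 'X_{1..N}) (m : nat) :
  (0 < N)%N -> (forall q, g q \is 2.-homog) ->
  (forall p, exists (u : Q -> {mpoly k[N]}) h,
     p = h + \sum_q u q * g q /\ forall M, h@_M != 0 -> reduced M) ->
  (forall (u : Q -> {mpoly k[N]}) h,
     h = \sum_q u q * g q -> (forall M, h@_M != 0 -> reduced M) -> h = 0) ->
  m = (#|Q| * N - ('C(N + 2, 3) - #|cubics reduced|))%N ->
  exists r : 'I_m -> {ffun Q -> {mpoly k[N]}^o},
  [/\ forall t q, (r t q : {mpoly k[N]}) \is 1.-homog,
      forall t, \sum_q (r t q : {mpoly k[N]}) * g q = 0,
      forall u : {ffun Q -> {mpoly k[N]}^o},
        (forall q, (u q : {mpoly k[N]}) \is 1.-homog) ->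
        \sum_q (u q : {mpoly k[N]}) * g q = 0 ->
        exists c : 'I_m -> k, u = \sum_t ((c t)%:MP : {mpoly k[N]}) *: r t
    & forall c : 'I_m -> k,
        \sum_t ((c t)%:MP : {mpoly k[N]}) *: r t = 0 -> forall t, c t = 0].
Proof.
case: N g reduced => // N g reduced _ hg nf ind.
rewrite addSnnS; exact: linear_syzygy_basis_succ.
Qed.

(** * The number of linear relations *)

Section Counting.

Variable n : nat.
Local Notation mon := 'X_{1..n * n}.

(* The reduced monomials represent a basis of S modulo the ideal of quadrics. *)
Definition reduced (M : mon) := sqfree M && (type_rep M == M).

Definition rowsupp (M : mon) := [set i | (0 < rowdeg M i)%N].
Definition colsupp (M : mon) := [set j | (0 < coldeg M j)%N].

Lemma sqfree_supp_inj M M' : sqfree M -> sqfree M' ->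
  rowsupp M = rowsupp M' -> colsupp M = colsupp M' -> same_type M M'.
Proof.
move=> /sqfreeP[r c] /sqfreeP[r' c'] /setP Er /setP Ec; apply/same_typeP.
split=> i.
  by have := Er i; rewrite !inE; move: (r i) (r' i); case: (rowdeg M i) => [|[]];
    case: (rowdeg M' i) => [|[]].
by have := Ec i; rewrite !inE; move: (c i) (c' i); case: (coldeg M i) => [|[]];
  case: (coldeg M' i) => [|[]].
Qed.

Lemma card_rowsupp M : sqfree M -> #|rowsupp M| = mdeg M.
Proof.
move=> /sqfreeP[r _]; rewrite mdeg_rowdeg -sum1_card big_mkcond /=.
by apply: eq_bigr => i _; rewrite inE; move: (r i); case: (rowdeg M i) => [|[]].
Qed.

Lemma card_colsupp M : sqfree M -> #|colsupp M| = mdeg M.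
Proof.
move=> /sqfreeP[_ c]; rewrite mdeg_coldeg -sum1_card big_mkcond /=.
by apply: eq_bigr => i _; rewrite inE; move: (c i); case: (coldeg M i) => [|[]].
Qed.

Lemma exists_supp d (A B : {set 'I_n}) : #|A| = d -> #|B| = d ->
  exists M, [/\ sqfree M, rowsupp M = A & colsupp M = B].
Proof.
elim: d A B => [|d IH] A B cA cB.
  have rc0 i : (rowdeg 0%MM i = 0%N) * (coldeg 0%MM i = 0%N).
    by split; [rewrite /rowdeg|rewrite /coldeg]; apply: big1 => j _; rewrite mnm0E.
  exists 0%MM; split.
  - by apply/sqfreeP; split=> i; rewrite rc0.
  - by move/cards0_eq: cA => ->; apply/setP => i; rewrite !inE rc0.
  - by move/cards0_eq: cB => ->; apply/setP => i; rewrite !inE rc0.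
have [a aA] : exists a, a \in A by apply/card_gt0P; rewrite cA.
have [b bB] : exists b, b \in B by apply/card_gt0P; rewrite cB.
have [||M [/sqfreeP[r c] EA EB]] := IH (A :\ a) (B :\ b).
- by move: cA; rewrite (cardsD1 a) aA => -[].
- by move: cB; rewrite (cardsD1 b) bB => -[].
have ra : rowdeg M a = 0%N.
  by move/setP/(_ a): EA; rewrite !inE eqxx /=; case: (rowdeg M a).
have cb : coldeg M b = 0%N.
  by move/setP/(_ b): EB; rewrite !inE eqxx /=; case: (coldeg M b).
exists (cell a b + M)%MM; split.
- apply/sqfreeP; split=> i; rewrite !degE.
    by case: eqP => [<-|_]; rewrite ?ra ?r.
  by case: eqP => [<-|_]; rewrite ?cb ?c.
- apply/setP => i; move/setP/(_ i): EA; rewrite !inE !degE eq_sym.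
  by case: eqP => [<-|_] //=; rewrite aA.
- apply/setP => i; move/setP/(_ i): EB; rewrite !inE !degE eq_sym.
  by case: eqP => [<-|_] //=; rewrite bB.
Qed.

(** A square-free multidegree amounts to its sets of rows and columns, so the reduced cubics
    correspond to pairs of three-element sets. *)
Lemma card_cubics : #|cubics reduced| = ('C(n, 3) ^ 2)%N.
Proof.
pose f (b : bmultinom (n * n) 4) := (rowsupp b, colsupp b).
pose draws := [set A : {set 'I_n} | #|A| == 3%N].
rewrite -(card_in_imset (f := f)).
  have <- : #|draws| = 'C(n, 3) by rewrite card_draws card_ord.
  rewrite -mulnn -cardsX; apply: eq_card => -[A B].
  rewrite in_setX; apply/imsetP/andP => [[b]|[]]; rewrite !inE.
    case/and3P=> /eqP d3 sq _ [-> ->].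
    by rewrite card_rowsupp // card_colsupp // d3.
  move=> /eqP cA /eqP cB; have [M [sqM EA EB]] := exists_supp cA cB.
  have st := type_repP M; have sqM' : sqfree (type_rep M).
    by rewrite -(sqfree_same_type st).
  have d3 : mdeg (type_rep M) = 3%N.
    rewrite -cA -EA card_rowsupp // !mdeg_rowdeg; apply: eq_bigr => i _.
    by case/same_typeP: st => ->.
  have lt4 : (mdeg (type_rep M) < 4)%N by rewrite d3.
  exists (BMultinom lt4); first rewrite inE; first apply/and3P; first split.
  - exact/eqP.
  - exact: sqM'.
  - exact/eqP/esym/eq_type_rep.
  case/same_typeP: st => r c; rewrite -EA -EB.
  by congr (_, _); apply/setP => i; rewrite !inE /= ?r ?c.
move=> b b'; rewrite !inE => /and3P[_ sq /eqP rep] /and3P[_ sq' /eqP rep'] [Er Ec].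
by apply: val_inj; rewrite /= -rep -rep'; apply/eq_type_rep/sqfree_supp_inj.
Qed.

Lemma card_le_pair : #|{: Defs.le_pair n}| = 'C(n.+1, 2).
Proof.
rewrite card_sig -sum1_card -bin2_sum big_mkord big_ord_recl add0n.
transitivity (\sum_(j < n) \sum_(i < n) nat_of_bool (i <= j))%N.
  rewrite [RHS]exchange_big [RHS]pair_bigA [LHS]big_mkcond /=.
  by apply: eq_bigr => -[i j] _; rewrite inE /=; case: leqP.
apply: eq_bigr => j _; rewrite lift0.
rewrite -[RHS](card_ord j.+1) -sum1_card (big_ord_widen n (fun=> 1%N)) //.
by rewrite [RHS]big_mkcond; apply: eq_bigr => i _; rewrite ltnS; case: leqP.
Qed.

Lemma linear_count : (0 < n)%N ->
  (4 * 'C(n.+1, 3) * 'C(n.+2, 3) =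
   #|{: quad_index n}| * (n * n) - ('C(n * n + 2, 3) - 'C(n, 3) ^ 2))%N.
Proof.
move=> n_gt0; rewrite card_prod card_le_pair.
have C2 : ('C(n.+1, 2) * 2 = n.+1 * n)%N.
  by apply: etrans (bin_ffact n.+1 2) _; rewrite !ffactnS ffactn0 muln1.
have C3 p : ('C(p, 3) * 6 = p * (p.-1 * p.-2))%N.
  by apply: etrans (bin_ffact p 3) _; rewrite !ffactnS ffactn0 muln1.
move: C2 (C3 n) (C3 n.+1) (C3 n.+2) (C3 (n * n + 2)%N); rewrite addn2 /=.
move: 'C(_, _) 'C(_, _) 'C(_, _) 'C(_, _) 'C(_, _) => q y a b z.
move=> Ez Eb Ea Ey Eq.
(* The subtractions are moved across, and the factor 36 clears the denominators of products of two
   binomials. *)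
have E : (4 * a * y + q = z * z * (n * n) + b ^ 2)%N.
  apply/eqP; rewrite -(eqn_pmul2l (isT : 0 < 36)%N); apply/eqP.
  have -> : (36 * (4 * a * y + q) = 4 * (a * 6) * (y * 6) + 6 * (q * 6))%N by ring.
  have -> : (36 * (z * z * (n * n) + b ^ 2) =
    9 * ((z * 2) * (z * 2) * (n * n)) + (b * 6) ^ 2)%N by ring.
  rewrite Ez Eb Ea Ey Eq; case: n n_gt0 => // -[|p] _ //=; ring.
(* Without this bound the inner subtraction would truncate. *)
suff le_bq : (b ^ 2 <= q)%N.
  have : (4 * a * y + (q - b ^ 2) = z * z * (n * n))%N.
    by apply: (@addIn (b ^ 2)%N); rewrite -addnA subnK.
  by move=> <-; rewrite addnK.
rewrite -(leq_pmul2l (isT : 0 < 36)%N).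
have -> : (36 * b ^ 2 = (b * 6) ^ 2)%N by ring.
have -> : (36 * q = 6 * (q * 6))%N by ring.
rewrite Eb Eq; have lep : (n.-1 * n.-2 <= n * n)%N by apply: leq_mul; lia.
have -> : ((n * (n.-1 * n.-2)) ^ 2 = (n * n) * ((n.-1 * n.-2) * (n.-1 * n.-2)))%N.
  by ring.
apply: (@leq_trans ((n * n) * ((n * n) * (n * n)))); first by apply: leq_mul => //; apply: leq_mul.
by move: (n * n)%N; clear; nia.
Qed.

End Counting.

Lemma linear_relation_basis (k : fieldType) (n : nat) (e : k) :
  (0 < n)%N -> e * e = 1 ->
  exists r : 'I_(4 * 'C(n.+1, 3) * 'C(n.+2, 3)) -> F1 k n,
  [/\ forall t, linear_relation (quadric e) (r t),
      forall u, linear_relation (quadric e) u ->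
        exists c : 'I_(4 * 'C(n.+1, 3) * 'C(n.+2, 3)) -> k,
          u = \sum_t ((c t)%:MP : {mpoly k[n * n]}) *: r t
    & forall c : 'I_(4 * 'C(n.+1, 3) * 'C(n.+2, 3)) -> k,
        \sum_t ((c t)%:MP : {mpoly k[n * n]}) *: r t = 0 -> forall t, c t = 0].
Proof.
move=> n_gt0 ee; have nn_gt0 : (0 < n * n)%N by rewrite muln_gt0 n_gt0.
have [p|u h Eh hrep||r [r1 r0 rspan rfree]] := @linear_syzygy_basis k (n * n) _
  (quadric e : quad_index n -> {mpoly k[n * n]}) (@reduced n)
  (4 * 'C(n.+1, 3) * 'C(n.+2, 3))%N nn_gt0 (quadric_homog e).
- have [u [h [Eg hrep]]] := quadric_normal_form ee p.
  exists (u : {ffun _ -> _}), h; split=> // M /hrep[sqM rM].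
  by rewrite /reduced sqM rM eqxx.
- apply: (reps_independent ee); last by move=> M /hrep/andP[sqM /eqP rM].
  rewrite Eh; have := apolar_d1 ee [ffun q => u q : {mpoly k[n * n]}^o].
  by rewrite /d1; congr (apolar _ _); apply: eq_bigr => q _; rewrite ffunE.
- by rewrite card_cubics linear_count.
exists r; split=> // [t|u [du hu]].
  by split; [apply: r0|move=> q; apply: r1].
exact: rspan.
Qed.

(** * Spans and the irredundancy of linear relations *)

Section Span.

Variables (k : fieldType) (n : nat) (I : finType) (r : I -> F1 k n).
Local Notation S := {mpoly k[n * n]}.

Definition in_span (u : F1 k n) := exists c : I -> S, u = \sum_t c t *: r t.

Lemma in_span_submodule : submodule in_span.
Proof.
split=> [|u v [c ->] [c' ->]|p u [c ->]].
- by exists (fun=> 0); rewrite big1 // => t _; rewrite scale0r.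
- exists (fun t => c t + c' t); rewrite -big_split.
  by apply: eq_bigr => t _; rewrite scalerDl.
- exists (fun t => p * c t); rewrite scaler_sumr.
  by apply: eq_bigr => t _; rewrite scalerA.
Qed.

Lemma in_span_gen t : in_span (r t).
Proof.
exists (fun t' => (t' == t)%:R); rewrite (bigD1 t) //= eqxx scale1r big1 ?addr0 //.
by move=> t' /negPf ->; rewrite scale0r.
Qed.

End Span.

Section MinimalLinear.

Variables (k : fieldType) (n : nat) (I : finType) (r : I -> F1 k n) (lin : pred I).
Local Notation S := {mpoly k[n * n]}.
Hypothesis r1 : forall t, lin t -> coefs_homog 1 (r t).
Hypothesis r2 : forall t, ~~ lin t -> coefs_homog 2 (r t).
Hypothesis rfree : forall c : I -> k,
  \sum_(t | lin t) ((c t)%:MP : S) *: r t = 0 -> forall t, lin t -> c t = 0.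

(** In degree one, quadratic relations contribute nothing and linear ones only through the constant
    terms of their coefficients, so a redundancy would contradict independence over k. *)
Lemma linear_irredundant (A : {set I}) t0 c : lin t0 -> t0 \notin A ->
  r t0 = \sum_(t in A) (c t : S) *: r t -> False.
Proof.
move=> l0 t0A E.
have low (p q : S) : q \is 2.-homog -> pihomog mdeg 1 (p * q) = 0.
  move=> hq; rewrite (mpolyE p) mulr_suml raddf_sum big1 //= => m _.
  have hm : 'X_[m] * q \is (mdeg m + 2).-homog by apply: dhomogM; rewrite ?dhomogX.
  by rewrite -scalerAl linearZ /= (pihomog_ne0 _ hm) ?scaler0 // addn2.
have const (p : S) : pihomog mdeg 0 p = (p@_0)%:MP.
  apply/mpolyP => M; rewrite mcoeff_pihomog mcoeffC mdeg_eq0.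
  by case: eqP => [->|_]; rewrite ?mulr1 ?mulr0.
pose a t := if t \in A then (c t)@_0 else 0.
pose rq t q : S := (r t : {ffun _ -> S^o}) q.
have Eq q : rq t0 q = \sum_(t | lin t) (a t)%:MP * rq t q.
  rewrite -[rq t0 q](pihomog_dE (r1 l0 q)) /rq E sum_ffunE raddf_sum /=.
  rewrite [RHS]big_mkcond [LHS]big_mkcond /=; apply: eq_bigr => t _.
  rewrite /a ffunE; case: ifP => tA; last by rewrite mpolyC0 mul0r if_same.
  case: ifPn => lt; first by rewrite -const; apply: (pihomogM 0 _ (r1 lt q)).
  exact/low/r2.
have : (t0 == t0)%:R - a t0 = 0.
  apply: (rfree (c := fun t => (t == t0)%:R - a t) _ l0).
  apply/ffunP => q; rewrite sum_ffunE ffunE; apply: (etrans (y := rq t0 q - rq t0 q)).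
    rewrite {2}Eq -[X in X - _]mul1r (_ : 1 * rq t0 q =
        \sum_(t | lin t) ((t == t0)%:R : S) * rq t q); last first.
      rewrite (bigD1 t0) //= eqxx big1 ?addr0 // => t /andP[_ /negPf ->].
      by rewrite mul0r.
    rewrite -sumrB; apply: eq_bigr => t _; rewrite ffunE -mulrBl mpolyCB.
    by rewrite mpolyC_nat.
  by rewrite subrr.
by rewrite eqxx /a (negPf t0A) subr0 => /eqP; rewrite oner_eq0.
Qed.

End MinimalLinear.

(** * A functional detecting the quadratic relations *)

Section Functional.

Variables (k : fieldType) (n : nat).
Local Notation S := {mpoly k[n * n]}.
Local Notation mon := 'X_{1..n * n}.

Lemma same_typeDl (m M M' : mon) : same_type (m + M)%MM (m + M')%MM = same_type M M'.
Proof.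
by congr (_ && _); apply: eq_forallb => i; rewrite ?rowdegD ?coldegD eqn_add2l.
Qed.

Lemma same_type_mdeg (M M' : mon) : same_type M M' -> mdeg M = mdeg M'.
Proof.
by case/same_typeP => h _; rewrite !mdeg_rowdeg; apply: eq_bigr => i _.
Qed.

(** The component of [p] in the multidegree of [M0], evaluated with all variables equal to 1. The
    two-term quadrics of the permanent vanish at this point. *)
Definition type_sum (M0 : mon) (p : S) : k :=
  extension (fun m c => if same_type M0 m then c else 0) p.

Lemma type_sumD M0 : {morph type_sum M0 : p q / p + q}.
Proof. by apply: extensionD => m a b; case: ifP; rewrite ?addr0. Qed.

Lemma type_sum0 M0 : type_sum M0 0 = 0.
Proof. exact: extension0. Qed.

Lemma type_sum_sum M0 (I : Type) (r : seq I) (P : pred I) (F : I -> S) :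
  type_sum M0 (\sum_(i <- r | P i) F i) = \sum_(i <- r | P i) type_sum M0 (F i).
Proof. exact: (big_morph _ (type_sumD M0) (type_sum0 M0)). Qed.

Lemma type_sumZX M0 c m : type_sum M0 (c *: 'X_[m]) = if same_type M0 m then c else 0.
Proof. by apply: extensionZX => m' a b; case: ifP; rewrite ?addr0. Qed.

Lemma type_sumMX M0 (p : S) M : type_sum M0 (p * 'X_[M]) =
  \sum_(m <- msupp p) if same_type M0 (m + M)%MM then p@_m else 0.
Proof.
rewrite {1}(mpolyE p) mulr_suml type_sum_sum; apply: eq_bigr => m _.
by rewrite -scalerAl -mpolyXD type_sumZX.
Qed.

Lemma type_sum_binomial M0 (p : S) M M' : same_type M M' ->
  type_sum M0 (p * ('X_[M] - 'X_[M'])) = 0.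
Proof.
move=> h; have N : type_sum M0 (p * ('X_[M] - 'X_[M'])) + type_sum M0 (p * 'X_[M']) =
    type_sum M0 (p * 'X_[M]).
  by rewrite -type_sumD -mulrDr subrK.
apply: (addIr (type_sum M0 (p * 'X_[M']))); rewrite N add0r !type_sumMX.
apply: eq_bigr => m _; rewrite same_typeC [in RHS]same_typeC.
by rewrite (@same_type_trans _ (m + M)%MM (m + M')%MM) // same_typeDl.
Qed.

Definition killer (q : quad_index n) : bool :=
  ((val q.1).1 == (val q.1).2) || ((val q.2).1 == (val q.2).2).

Lemma lead_trail_type q : same_type (@lead n q) (trail q).
Proof.
by apply/same_typeP; split=> t; rewrite !degE // addnC.
Qed.

Lemma quadric_killer e q : killer q -> quadric e q = 'X_[lead q] :> S.
Proof.
rewrite quadricE /killer; case/orP => /eqP ->; rewrite eqxx /= ?addr0 //.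
by case: ifP; rewrite addr0.
Qed.

Lemma perm_quadric_edge q : ~~ killer q ->
  quadric (- 1) q = 'X_[lead q] - 'X_[trail q] :> S.
Proof.
rewrite negb_or => /andP[n1 n2].
by rewrite quadricE n1 n2 scaleN1r.
Qed.

Variables (P : pred (quad_index n)) (M0 : mon).
Hypothesis P_killer : forall q, P q -> killer q.
Hypothesis P_exclusive : forall q0 z0 m, P q0 -> mdeg z0 = 1%N ->
  same_type M0 (m + (z0 + lead q0))%MM ->
  forall q z, killer q -> ~~ P q -> mdeg z = 1%N ->
    ~~ same_type (z0 + lead q0)%MM (z + lead q)%MM.

(** Summed over all killers this would be [type_sum M0] of [d1 u] for the permanent, hence zero on
    every relation. Keeping only the killers in [P] is what allows a nonzero value on a defect. *)
Definition Phi (u : F1 k n) : k :=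
  \sum_(q | P q) type_sum M0 (((u : {ffun _ -> S^o}) q : S) * 'X_[lead q]).

Lemma PhiD : {morph Phi : u v / u + v}.
Proof.
move=> u v; rewrite /Phi -big_split; apply: eq_bigr => q _.
by rewrite ffunE mulrDl type_sumD.
Qed.

Lemma Phi0 : Phi 0 = 0.
Proof. by rewrite /Phi big1 // => q _; rewrite ffunE mul0r type_sum0. Qed.

Lemma PhiB u v : Phi (u - v) = Phi u - Phi v.
Proof. by apply: (addIr (Phi v)); rewrite -PhiD !subrK. Qed.

Lemma Phi_sum (I : Type) (r : seq I) (Q : pred I) (F : I -> F1 k n) :
  Phi (\sum_(i <- r | Q i) F i) = \sum_(i <- r | Q i) Phi (F i).
Proof. exact: (big_morph _ PhiD Phi0). Qed.

(* If P meets the multidegree of the shifted relation at all, no other killer does;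
   the edges cancel in d1, so that Phi only reads off a coefficient sum of d1 l = 0. *)
Lemma Phi_linear_relation (c : S) l : linear_relation (quadric (- 1)) l ->
  Phi (c *: l) = 0.
Proof.
move=> [dl l1]; rewrite (mpolyE c) scaler_suml Phi_sum big1 // => m _.
move: (c@_m) => a {c}.
pose lq q : S := (l : {ffun _ -> S^o}) q.
have l1' q z : z \in msupp (lq q) -> mdeg z = 1%N by apply: dhomog_mf (l1 q) z.
have PhiE : Phi ((a *: 'X_[m] : S) *: l) =
    a * \sum_(q | P q) \sum_(z <- msupp (lq q))
      (if same_type M0 (m + (z + lead q))%MM then (lq q)@_z else 0).
  rewrite /Phi mulr_sumr; apply: eq_bigr => q _; rewrite ffunE.
  have -> : ((a *: 'X_[m] : S) *: ((l : {ffun _ -> S^o}) q : S^o) : S) * 'X_[lead q] =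
      \sum_(z <- msupp (lq q)) (a * (lq q)@_z) *: 'X_[m + (z + lead q)].
    rewrite -/(lq q) [in LHS](mpolyE (lq q)) scaler_sumr mulr_suml.
    apply: eq_bigr => z _; rewrite [X in X * _ = _](_ : _ = a *: 'X_[m] * ((lq q)@_z *: 'X_[z])) //.
    by rewrite -scalerAl -scalerAr scalerA -scalerAl !mpolyXD mulrA.
  rewrite type_sum_sum mulr_sumr; apply: eq_bigr => z _.
  by rewrite type_sumZX; case: ifP; rewrite ?mulr0.
rewrite PhiE; set Z := \sum_(q | P q) _; suff -> : Z = 0 by rewrite mulr0.
have [/existsP[q0 /andP[Pq0 /hasP[z0 z0l h0]]]|none] := boolP [exists q, P q &&
    has (fun z => same_type M0 (m + (z + lead q))%MM) (msupp (lq q))]; last first.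
  rewrite /Z big1 // => q Pq; rewrite big_seq big1 // => z zl.
  case: ifP => // h; case/negP: none; apply/existsP; exists q; rewrite Pq.
  by apply/hasP; exists z.
have excl := P_exclusive Pq0 (l1' _ _ z0l) h0.
set M1 := (z0 + lead q0)%MM in excl h0.
have -> : Z = type_sum M1 (d1 (quadric (- 1)) l).
  rewrite type_sum_sum [RHS](bigID P) /= [X in _ + X]big1 ?addr0 => [|q nPq].
    apply: eq_bigr => q Pq.
    rewrite [RHS](_ : _ = type_sum M1 (lq q * 'X_[lead q])).
      rewrite type_sumMX; apply: eq_bigr => z _.
      by rewrite (same_type_trans _ h0) same_typeDl.
    by rewrite -(quadric_killer (- 1) (P_killer Pq)).
  have [kq|nkq] := boolP (killer q); last first.
    have := type_sum_binomial M1 (lq q) (lead_trail_type q).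
    by rewrite -(perm_quadric_edge nkq).
  rewrite [LHS](_ : _ = type_sum M1 (lq q * 'X_[lead q])); last first.
    by rewrite -(quadric_killer (- 1) kq).
  rewrite type_sumMX big_seq big1 // => z zl.
  by rewrite (negPf (excl q z kq nPq (l1' _ _ zl))).
by rewrite (dl : d1 _ _ = 0) type_sum0.
Qed.

Lemma Phi_basis (c : S) q M :
  Phi (c *: (('X_[M] : S) *: basis_symbol k q)) =
  (P q)%:R * type_sum M0 (c * 'X_[M + lead q]).
Proof.
have E q' : (((c *: (('X_[M] : S) *: basis_symbol k q)) : {ffun _ -> S^o}) q' : S) =
    if q' == q then c * 'X_[M] else 0.
  rewrite !ffunE; case: eqP => _.
    by rewrite /GRing.scale /= mulr1.
  by rewrite !scaler0.
rewrite /Phi; have [Pq|nPq] := boolP (P q).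
  rewrite (bigD1 q) //= E eqxx mpolyXD mulrA mul1r big1 ?addr0 // => q' /andP[_ nq].
  by rewrite E (negPf nq) mul0r type_sum0.
rewrite big1 ?mul0r // => q' Pq'; rewrite E; case: eqP => [Eq|_].
  by rewrite -Eq Pq' in nPq.
by rewrite mul0r type_sum0.
Qed.

Lemma type_sum_top (c : S) M : mdeg M = mdeg M0 ->
  type_sum M0 (c * 'X_[M]) = c@_0 * (same_type M0 M)%:R.
Proof.
move=> dM; rewrite type_sumMX.
have z m : same_type M0 (m + M)%MM -> m = 0%MM.
  move/same_type_mdeg; rewrite mdegD dM => /eqP.
  by rewrite -{1}[mdeg M0]add0n eqn_add2r eq_sym mdeg_eq0 => /eqP.
have [c0|nc0] := boolP (0%MM \in msupp c).
  rewrite (bigD1_seq 0%MM) ?msupp_uniq //= add0m big1 ?addr0.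
    by case: same_type; rewrite ?mulr1 ?mulr0.
  by move=> m nm; case: ifP => // /z m0; rewrite m0 eqxx in nm.
rewrite (memN_msupp_eq0 nc0) mul0r big_seq big1 // => m mc.
by case: ifP => // /z m0; rewrite -m0 mc in nc0.
Qed.

Lemma Phi_basisB (c : S) q1 q2 M1 M2 M : mdeg M = mdeg M0 ->
  (M2 + lead q1 = M)%MM -> (M1 + lead q2 = M)%MM ->
  Phi (c *: (('X_[M2] : S) *: basis_symbol k q1 - ('X_[M1] : S) *: basis_symbol k q2)) =
  ((P q1)%:R - (P q2)%:R) * (c@_0 * (same_type M0 M)%:R).
Proof.
move=> dM E1 E2; rewrite scalerBr PhiB mulrBl -type_sum_top //.
by congr (_ - _); rewrite Phi_basis (E1, E2).
Qed.

End Functional.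

(** * The multidegrees of the quadratic relations *)

Section QuadraticIndex.

Variable n : nat.
Local Notation mon := 'X_{1..n * n}.

Definition increasing d : {set d.-tuple 'I_n} :=
  [set t : d.-tuple 'I_n | sorted ltn (map val t)].

(* A multidegree supporting a quadratic relation of the permanent: two lines of
   the same direction (rows if the Boolean is true) and four lines of the other. *)
Definition quadratic_index : finType := (bool * 2.-tuple 'I_n * 4.-tuple 'I_n)%type.

Definition quadratic_indices : {set quadratic_index} :=
  setX (setX [set: bool] (increasing 2)) (increasing 4).

Lemma card_quadratic_indices : #|quadratic_indices| = (2 * 'C(n, 2) * 'C(n, 4))%N.
Proof.
by rewrite !cardsX cardsT card_bool /increasing !card_ltn_sorted_tuples.
Qed.

Definition wcell (w : quadratic_index) (t : 'I_2) (u : 'I_4) : 'I_n * 'I_n :=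
  let: (rows, p, b) := w in
  if rows then (tnth p t, tnth b u) else (tnth b u, tnth p t).

Local Notation o2 i := (@Ordinal 2 i isT).
Local Notation o4 i := (@Ordinal 4 i isT).
Local Notation cellp z := (cell z.1 z.2).
Local Notation z1 w := (wcell w (o2 0) (o4 0)).
Local Notation z2 w := (wcell w (o2 0) (o4 1)).
Local Notation z3 w := (wcell w (o2 1) (o4 2)).
Local Notation z4 w := (wcell w (o2 1) (o4 3)).

Definition wmnm (w : quadratic_index) : mon :=
  (cellp (z1 w) + cellp (z2 w) + (cellp (z3 w) + cellp (z4 w)))%MM.

Lemma increasingP d (t : d.-tuple 'I_n) (i j : 'I_d) :
  t \in increasing d -> (i < j)%N -> (tnth t i < tnth t j)%N.
Proof.
rewrite inE => st lt; have x0 := tnth t i; rewrite !(tnth_nth x0).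
have := @sorted_ltn_nth _ _ ltn_trans 0%N _ st i j.
rewrite !inE size_map size_tuple => /(_ (ltn_ord i) (ltn_ord j) lt).
by rewrite !(nth_map x0) ?size_tuple.
Qed.

Lemma increasing_inj d (t t' : d.-tuple 'I_n) :
  t \in increasing d -> t' \in increasing d -> t =i t' -> t = t'.
Proof.
rewrite !inE => st st' E; apply/val_inj/(inj_map val_inj).
apply: (irr_sorted_eq ltn_trans ltnn st st') => y.
by apply/mapP/mapP => -[x xt ->]; exists x; rewrite // ?E // -E.
Qed.

Definition pair_deg (p : 2.-tuple 'I_n) (i : 'I_n) : nat :=
  ((tnth p (o2 0) == i) + (tnth p (o2 0) == i) +
   ((tnth p (o2 1) == i) + (tnth p (o2 1) == i)))%N.

Definition quad_deg (b : 4.-tuple 'I_n) (j : 'I_n) : nat :=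
  ((tnth b (o4 0) == j) + (tnth b (o4 1) == j) +
   ((tnth b (o4 2) == j) + (tnth b (o4 3) == j)))%N.

Lemma wmnm_deg rows p b :
  (rowdeg (wmnm (rows, p, b)) =1 if rows then pair_deg p else quad_deg b) /\
  (coldeg (wmnm (rows, p, b)) =1 if rows then quad_deg b else pair_deg p).
Proof. by case: rows; split=> t; rewrite !degE. Qed.

Lemma mem_pair_deg p i : (i \in p) = (0 < pair_deg p i)%N.
Proof.
rewrite /pair_deg !(tnth_nth i) /=; case: p => [[|a [|b []]] //= hp].
by rewrite memtE !inE /= [i == a]eq_sym [i == b]eq_sym; do 2!case: (_ == _).
Qed.

Lemma mem_quad_deg b j : (j \in b) = (0 < quad_deg b j)%N.
Proof.
rewrite /quad_deg !(tnth_nth j) /=; case: b => [[|a [|b [|c [|d []]]]] //= hb].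
rewrite memtE !inE /= [j == a]eq_sym [j == b]eq_sym [j == c]eq_sym [j == d]eq_sym.
by do 4!case: (_ == _).
Qed.

Lemma pair_deg_ge2 p : (1 < pair_deg p (tnth p (o2 0)))%N.
Proof. by rewrite /pair_deg eqxx. Qed.

Lemma quad_deg_le1 b j : b \in increasing 4 -> (quad_deg b j <= 1)%N.
Proof.
move=> hb; rewrite /quad_deg.
have lt (u v : 'I_4) : (u < v)%N -> (tnth b u == j) -> (tnth b v == j) = false.
  move=> luv /eqP <-; rewrite -(inj_eq val_inj) gtn_eqF //.
  exact: increasingP hb luv.
case: (tnth b (o4 0) =P j) => [/eqP h|_]; first by rewrite !(lt _ _ _ h).
case: (tnth b (o4 1) =P j) => [/eqP h|_]; first by rewrite !(lt _ _ _ h).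
case: (tnth b (o4 2) =P j) => [/eqP h|_]; first by rewrite !(lt _ _ _ h).
by case: (_ == _).
Qed.

(** The two lines carry degree two and the four transversal ones degree one, so the multidegree
    reveals the direction; the increasing tuples are recovered from their supports. *)
Lemma wmnm_inj w w' : w \in quadratic_indices -> w' \in quadratic_indices ->
  same_type (wmnm w) (wmnm w') -> w = w'.
Proof.
case: w w' => [[rows p] b] [[rows' p'] b']; rewrite !in_setX !in_setT /=.
move=> /andP[hp hb] /andP[hp' hb'] /same_typeP[].
have [r c] := wmnm_deg rows p b; have [r' c'] := wmnm_deg rows' p' b'.
move=> er ec.
have er' i := etrans (esym (r i)) (etrans (er i) (r' i)).
have ec' i := etrans (esym (c i)) (etrans (ec i) (c' i)).
have finish : pair_deg p =1 pair_deg p' -> quad_deg b =1 quad_deg b' ->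
    (p, b) = (p', b').
  move=> e1 e2; congr (_, _); apply: increasing_inj => // i.
    by rewrite !mem_pair_deg e1.
  by rewrite !mem_quad_deg e2.
case: rows rows' {r c r' c' er ec} er' ec' => -[] er ec.
- by case: (finish er ec) => -> ->.
- have := pair_deg_ge2 p; rewrite er => /leq_trans/(_ (quad_deg_le1 _ hb')).
  by rewrite ltnn.
- have := pair_deg_ge2 p; rewrite ec => /leq_trans/(_ (quad_deg_le1 _ hb')).
  by rewrite ltnn.
- by case: (finish ec er) => -> ->.
Qed.

Definition line_pred (w : quadratic_index) (q : quad_index n) : bool :=
  let: (rows, p, b) := w in
  let c := tnth p (o2 0) in
  if rows then val q.1 == (c, c) else val q.2 == (c, c).

Lemma line_pred_killer w q : line_pred w q -> killer q.
Proof.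
case: w => [[[] p] b]; rewrite /killer /= => /eqP ->; by rewrite eqxx ?orbT.
Qed.

(** A killer in the transversal direction needs degree two where [wmnm w] has at most one. A killer
    on another parallel line needs degree two there, but [lead q0] lies wholly on the first line and
    [z0] contributes at most one. *)
Lemma line_pred_exclusive w : w \in quadratic_indices ->
  forall q0 z0 m, line_pred w q0 -> mdeg z0 = 1%N ->
  same_type (wmnm w) (m + (z0 + lead q0))%MM ->
  forall q z, killer q -> ~~ line_pred w q -> mdeg z = 1%N ->
    ~~ same_type (z0 + lead q0)%MM (z + lead q)%MM.
Proof.
case: w => [[rows p] b]; rewrite !in_setX !in_setT /= => /andP[hp hb].
move=> q0 z0 m P0 d0 /same_typeP[]; have [r c] := wmnm_deg rows p b.
move=> er ec q z kq nP _; apply/negP => /same_typeP[hr hc].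
have rz i : (rowdeg z0 i <= 1)%N.
  by rewrite -d0 mdeg_rowdeg (bigD1 i) //= leq_addr.
have cz i : (coldeg z0 i <= 1)%N.
  by rewrite -d0 mdeg_coldeg (bigD1 i) //= leq_addr.
have le_r i : (rowdeg (z + lead q) i <= rowdeg (wmnm (rows, p, b)) i)%N.
  by rewrite -hr er [rowdeg (m + _) i]rowdegD leq_addl.
have le_c i : (coldeg (z + lead q) i <= coldeg (wmnm (rows, p, b)) i)%N.
  by rewrite -hc ec [coldeg (m + _) i]coldegD leq_addl.
have same_row i : (val q.1).1 = i -> (val q.1).2 = i ->
    exists a a', lead q = (cell i a + cell i a')%MM.
  by rewrite /lead => -> ->; exists (val q.2).1, (val q.2).2.
have same_col j : (val q.2).1 = j -> (val q.2).2 = j ->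
    exists a a', lead q = (cell a j + cell a' j)%MM.
  by rewrite /lead => -> ->; exists (val q.1).1, (val q.1).2.
case: rows P0 nP r c {er ec} le_r le_c => /= /eqP P0 nP r c le_r le_c.
- have [a [a' E0]] : exists a a',
      lead q0 = (cell (tnth p (o2 0)) a + cell (tnth p (o2 0)) a')%MM.
    by rewrite /lead /= P0; exists (val q0.2).1, (val q0.2).2.
  case/orP: kq => /eqP kq; last first.
    have [a1 [a1' E1]] := same_col _ kq erefl.
    have := le_c (val q.2).2; rewrite c E1 !degE eqxx.
    by move/leq_trans/(_ (quad_deg_le1 _ hb)); rewrite addnC.
  have [a1 [a1' E1]] := same_row _ kq erefl.
  have := hr (val q.1).2; rewrite E0 E1 !degE eqxx.
  have -> : tnth p (o2 0) == (val q.1).2 = false.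
    apply: contraNF nP => /eqP ->; apply/eqP; move: kq => /=.
    by case: (sval q.1) => u v /= ->.
  by rewrite !addn0 => E; have := rz (val q.1).2; rewrite E addnC.
- have [a [a' E0]] : exists a a',
      lead q0 = (cell a (tnth p (o2 0)) + cell a' (tnth p (o2 0)))%MM.
    by rewrite /lead /= P0; exists (val q0.1).1, (val q0.1).2.
  case/orP: kq => /eqP kq.
    have [a1 [a1' E1]] := same_row _ kq erefl.
    have := le_r (val q.1).2; rewrite r E1 !degE eqxx.
    by move/leq_trans/(_ (quad_deg_le1 _ hb)); rewrite addnC.
  have [a1 [a1' E1]] := same_col _ kq erefl.
  have := hc (val q.2).2; rewrite E0 E1 !degE eqxx.
  have -> : tnth p (o2 0) == (val q.2).2 = false.
    apply: contraNF nP => /eqP ->; apply/eqP; move: kq => /=.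
    by case: (sval q.2) => u v /= ->.
  by rewrite !addn0 => E; have := cz (val q.2).2; rewrite E addnC.
Qed.

End QuadraticIndex.

(** * The quadratic relations and their dual functionals *)

Section QuadraticRelations.

Variables (k : fieldType) (n : nat).
Local Notation S := {mpoly k[n * n]}.
Local Notation x := (@mxvar k n).
Local Notation xp z := (x z.1 z.2).
Local Notation cellp z := (cell z.1 z.2).
Local Notation E := (symbol (- 1 : k)).
Local Notation Ep z w := (E z.1 z.2 w.1 w.2).
Local Notation o2 i := (@Ordinal 2 i isT).
Local Notation o4 i := (@Ordinal 4 i isT).
Local Notation z1 w := (wcell w (o2 0) (o4 0)).
Local Notation z2 w := (wcell w (o2 0) (o4 1)).
Local Notation z3 w := (wcell w (o2 1) (o4 2)).
Local Notation z4 w := (wcell w (o2 1) (o4 3)).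

Let NN : - 1 * - 1 = 1 :> k.
Proof. by rewrite mulrNN mulr1. Qed.

(** The defect for the split of the transversal lines into the first two and the last two; the other
    splits agree with it up to sign modulo the linear relations. *)
Definition quadratic_rel (w : quadratic_index n) : F1 k n :=
  (xp (z3 w) * xp (z4 w)) *: Ep (z1 w) (z2 w) -
  (xp (z1 w) * xp (z2 w)) *: Ep (z3 w) (z4 w).

Lemma wcell_line (w : quadratic_index n) t u v : line (wcell w t u) (wcell w t v).
Proof. by case: w => [[[] p] b]; rewrite /line /= eqxx ?orbT. Qed.

Lemma quadratic_relP (w : quadratic_index n) : quadratic_relation (quadric (- 1)) (quadratic_rel w).
Proof.
split.
  have d1_line z z' : line z z' -> d1 (quadric (- 1)) (Ep z z') = xp z * xp z'.
    by move=> l; rewrite d1_symbol // ifT.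
  have syzygy (p q : S) u v : p * d1 (quadric (- 1)) u = q * d1 (quadric (- 1)) v ->
      relation (quadric (- 1)) (p *: u - q *: v).
    by move=> eq_pq; rewrite /relation d1B !d1Z eq_pq subrr.
  apply: syzygy.
  apply: (etrans (congr1 _ (d1_line _ _ (wcell_line w _ _ _)))).
  apply: (etrans (mulrC _ _)); apply/esym.
  exact: (congr1 _ (d1_line _ _ (wcell_line w _ _ _))).
have h (z z' : 'I_n * 'I_n) : xp z * xp z' \is 2.-homog.
  by apply: (dhomogM (d := 1) (e := 1)); apply: mxvar_homog.
by apply: coefs_homogB; apply: (@coefs_homogZ _ _ 0 2) => //; apply: coefs_homog_symbol.
Qed.

Definition line_symbol (z z' : 'I_n * 'I_n) : quad_index n :=
  (sort_pair z.1 z'.1, sort_pair z.2 z'.2).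

Lemma symbol_line z z' : line z z' -> Ep z z' = basis_symbol k (line_symbol z z').
Proof.
rewrite /line /symbol => l.
rewrite ifT; first exact: scale1r.
by rewrite orbA l.
Qed.

Lemma lead_line_symbol (z z' : 'I_n * 'I_n) : (z.1 <= z'.1)%N -> (z.2 <= z'.2)%N ->
  lead (line_symbol z z') = (cellp z + cellp z')%MM.
Proof. by rewrite /lead /= => -> ->. Qed.

Lemma wcell_le (w : quadratic_index n) (t t' : 'I_2) (u u' : 'I_4) : w \in quadratic_indices n ->
  (t <= t')%N -> (u < u')%N ->
  ((wcell w t u).1 <= (wcell w t' u').1)%N /\ ((wcell w t u).2 <= (wcell w t' u').2)%N.
Proof.
case: w => [[rows p] b]; rewrite !in_setX in_setT /= => /andP[hp hb] le_t ltu.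
have h1 : (tnth p t <= tnth p t')%N.
  move: le_t; rewrite leq_eqVlt => /orP[/eqP/val_inj -> //|].
  by move/(increasingP hp)/ltnW.
have h2 := ltnW (increasingP hb ltu).
by case: rows {hp hb}.
Qed.

Lemma line_pred_line_symbol (w : quadratic_index n) t u v : w \in quadratic_indices n ->
  line_pred w (line_symbol (wcell w t u) (wcell w t v)) = (t == o2 0).
Proof.
case: w => [[rows p] b]; rewrite !in_setX in_setT /= => /andP[hp hb].
have h : (tnth p t == tnth p (o2 0)) = (t == o2 0).
  apply/eqP/eqP => [E|-> //]; case: (ltnP 0 t) => [lt|].
    have := increasingP (i := o2 0) hp lt.
    by rewrite E ltnn.
  by rewrite leqn0 => /eqP t0; apply: val_inj.
by case: rows; rewrite /= leqnn xpair_eqE h andbb.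
Qed.

(** All [wmnm] have degree four, so only the constant term of [c] can reach the multidegree of w,
    and [wmnm_inj] separates the indices. For w itself, exactly one of the two terms lies on the
    line that [Phi] reads. *)
Lemma Phi_quadratic_rel (w w' : quadratic_index n) (c : S) :
  w \in quadratic_indices n -> w' \in quadratic_indices n ->
  Phi (line_pred w) (wmnm w) (c *: quadratic_rel w') =
    if w == w' then c@_0%MM else 0.
Proof.
move=> hw hw'.
have [le1 le1'] := wcell_le (t := o2 0) (t' := o2 0) (u := o4 0) (u' := o4 1) hw' isT isT.
have [le2 le2'] := wcell_le (t := o2 1) (t' := o2 1) (u := o4 2) (u' := o4 3) hw' isT isT.
have E1 : (cellp (z3 w') + cellp (z4 w') + lead (line_symbol (z1 w') (z2 w')) = wmnm w')%MM.
  by rewrite lead_line_symbol // addmC.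
have E2 : (cellp (z1 w') + cellp (z2 w') + lead (line_symbol (z3 w') (z4 w')) = wmnm w')%MM.
  by rewrite lead_line_symbol.
have dM : mdeg (wmnm w') = mdeg (wmnm w) by rewrite /wmnm !mdegD !mdeg1.
have := Phi_basisB (line_pred w) c dM E1 E2.
rewrite /quadratic_rel !symbol_line ?wcell_line // !mpolyXD => ->.
have [<-|ne] := eqVneq w w'.
  by rewrite !line_pred_line_symbol // same_type_refl subr0 mul1r mulr1.
case: (boolP (same_type _ _)) => [st|]; last by rewrite !mulr0.
by case/eqP: ne; apply: wmnm_inj.
Qed.

End QuadraticRelations.

(** * The relation modules *)

Section Determinant.

Variables (k : fieldType) (n : nat).
Local Notation S := {mpoly k[n * n]}.

Lemma prod_generic_mx (s : 'S_n) :
  \prod_i generic_mx k n i (s i) = 'X_[perm_mnm s] :> S.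
Proof.
rewrite /perm_mnm (big_morph _ (@mpolyXD (n * n) k) (@mpolyX0 (n * n) k)).
by apply: eq_bigr => i _; rewrite mxE.
Qed.

Lemma det_immanant : det_poly k n = immanant n (1 : k).
Proof.
apply: eq_bigr => s _; rewrite prod_generic_mx.
by case: (s : bool); rewrite ?expr1 ?expr0 ?mulN1r ?scaleN1r ?mul1r ?scale1r.
Qed.

Lemma perm_immanant : perm_poly k n = immanant n (- 1 : k).
Proof.
apply: eq_bigr => s _; rewrite prod_generic_mx opprK expr1n; exact/esym/scale1r.
Qed.

Lemma minimally_generatesP (I : finType) (r : I -> F1 k n) (M : F1 k n -> Prop) :
  (forall t, M (r t)) -> (forall u, M u -> in_span r u) ->
  (forall (A : {set I}) t0 (c : I -> S), t0 \notin A ->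
     r t0 <> \sum_(t in A) c t *: r t) ->
  minimally_generates r M.
Proof.
move=> rM span irr; split.
  split=> [t _|u /span[c ->]]; first exact: rM.
  by exists c; apply: eq_bigl => t; rewrite in_setT.
move=> A /properP[_ [t0 _ t0A]] [_ gen].
by have [c] := gen _ (rM t0); apply: irr.
Qed.

Lemma in_span_linear (e : k) (I J : finType) (r : I -> F1 k n) (f : J -> I) :
  (forall u, linear_relation (quadric e) u ->
     exists c : J -> k, u = \sum_t ((c t)%:MP : S) *: r (f t)) ->
  forall u, linear_relation (quadric e) u -> in_span r u.
Proof.
move=> h u /h[c ->]; have HN := in_span_submodule r.
apply: big_ind => [||t _]; [exact: sub0 HN|by move=> *; apply: (subD HN)|].
by apply: (subZ HN); apply: in_span_gen.
Qed.

End Determinant.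

Lemma det_relations (k : fieldType) (n : nat) : (0 < n)%N -> 2%N \notin [pchar k] ->
  exists r : 'I_(4 * 'C(n.+1, 3) * 'C(n.+2, 3)) -> F1 k n,
    (forall t, linear_relation (@det_quadric k n) (r t)) /\
    minimally_generates r (relation (@det_quadric k n)).
Proof.
move=> n_gt0 char2.
have ee : 1 * 1 = 1 :> k by rewrite mulr1.
have [r [r1 rspan rfree]] := linear_relation_basis n_gt0 ee.
exists r; split=> //; apply: minimally_generatesP => [t|u|A t0 c t0A].
- by case: (r1 t).
- have HN := in_span_submodule r; have HL := in_span_linear (f := id) rspan.
  have HE := symbol_relations ee HL.
  (* The assumption on the characteristic enters here, as the invertibility of 2. *)
  have hh : 2 * (2^-1)%:MP = 1 :> {mpoly k[n * n]}.
    rewrite -(mpolyC_nat _ _ 2) -mpolyCM divff ?mpolyC1 //.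
  have four := four_relations_half HN (eeS n ee) HE (mpolyC1 _ _) hh.
  have fourT := four_relations_half HN (eeS n ee) (basic_relationsT HN HE) (mpolyC1 _ _) hh.
  exact: (relations_generated ee HN HL four fourT).
- apply: (linear_irredundant (lin := predT) _ _ _ isT t0A) => // [t _|b /rfree b0 t _].
    by case: (r1 t).
  exact: b0.
Qed.

Section Permanent.

Variables (k : fieldType) (n : nat).
Local Notation S := {mpoly k[n * n]}.
Local Notation x := (@mxvar k n).
Local Notation E := (symbol (- 1 : k)).

Let NN : - 1 * - 1 = 1 :> k.
Proof. by rewrite mulrNN mulr1. Qed.

Lemma tuple2_increasing (i j : 'I_n) : (i < j)%N -> [tuple i; j] \in increasing n 2.
Proof. by move=> ij; rewrite inE /= ij. Qed.

Lemma tuple4_increasing (a b c d : 'I_n) : (a < b)%N -> (b < c)%N -> (c < d)%N ->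
  [tuple a; b; c; d] \in increasing n 4.
Proof. by move=> ab bc cd; rewrite inE /= ab bc cd. Qed.

Lemma perm_relations_generated (N : F1 k n -> Prop) : submodule N ->
  (forall u, linear_relation (quadric (- 1)) u -> N u) ->
  (forall w, w \in quadratic_indices n -> N (quadratic_rel k w)) ->
  forall u, relation (quadric (- 1)) u -> N u.
Proof.
move=> HN HL Hw.
have HE : basic_relations (- 1) N x E.
  by have := symbol_relations NN HL; rewrite mpolyCN mpolyC1.
have HET := basic_relationsT HN HE.
have Hw' rows (i j a b c d : 'I_n) : (i < j)%N -> (a < b)%N -> (b < c)%N -> (c < d)%N ->
    N (quadratic_rel k (rows, [tuple i; j], [tuple a; b; c; d])).
  move=> ij ab bc cd; apply: Hw; rewrite !in_setX in_setT.
  by rewrite tuple2_increasing // tuple4_increasing.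
apply: (relations_generated NN HN HL).
  (* On rows [quadratic_rel] unfolds to the row defect, and on columns to the row defect of the
     transposed families. *)
  apply: (four_relations_sorted HN HE) => i j a b c d ij ab bc cd.
  exact: (Hw' true).
apply: (four_relations_sorted HN HET) => i j a b c d ij ab bc cd.
exact: (Hw' false).
Qed.

End Permanent.

Lemma perm_relations (k : fieldType) (n : nat) : (0 < n)%N ->
  exists r : 'I_(4 * 'C(n.+1, 3) * 'C(n.+2, 3)) + 'I_(2 * 'C(n, 2) * 'C(n, 4)) -> F1 k n,
    (forall t, linear_relation (@perm_quadric k n) (r (inl t))) /\
    (forall t, quadratic_relation (@perm_quadric k n) (r (inr t))) /\
    minimally_generates r (relation (@perm_quadric k n)).
Proof.
move=> n_gt0.
have NN : - 1 * - 1 = 1 :> k by rewrite mulrNN mulr1.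
have [l [l1 lspan lfree]] := linear_relation_basis n_gt0 NN.
rewrite -(card_quadratic_indices n).
pose r (t : 'I_(4 * 'C(n.+1, 3) * 'C(n.+2, 3)) + 'I_#|quadratic_indices n|) : F1 k n :=
  match t with inl t => l t | inr t => quadratic_rel k (enum_val t) end.
exists r; split; [exact: l1|split=> [t|]; first exact: quadratic_relP].
apply: minimally_generatesP => [[t|t]|u|A t0 c t0A].
- by case: (l1 t).
- by case: (quadratic_relP k (enum_val t)).
- apply: perm_relations_generated => [||w hw]; first exact: in_span_submodule.
    exact: (in_span_linear (f := inl) lspan).
  by have := in_span_gen r (inr (enum_rank_in hw w)); rewrite /= enum_rankK_in.
pose lin (t : 'I_(4 * 'C(n.+1, 3) * 'C(n.+2, 3)) + 'I_#|quadratic_indices n|) : bool :=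
  if t is inl _ then true else false.
case: t0 t0A => [t0|t0] t0A.
  apply: (linear_irredundant (r := r) (lin := lin) (t0 := inl t0) _ _ _ isT t0A) => [[t|t] //|[t|t] //|b].
  - by move=> _; case: (l1 t).
  - by move=> _; case: (quadratic_relP k (enum_val t)).
  move=> b0 [t|t] // _; apply: (lfree (fun t => b (inl t))).
  by move: b0; rewrite big_sumType /= [X in _ + X]big_pred0 ?addr0.
pose w0 := enum_val t0; have hw0 : w0 \in quadratic_indices n := enum_valP t0.
(* The functional of [w0] takes the value 1 on its own relation and vanishes on all multiples of the
   other generators. *)
move=> /(congr1 (Phi (line_pred w0) (wmnm w0))); rewrite Phi_sum big1 => [|t tA].
  have := Phi_quadratic_rel (1 : {mpoly k[n * n]}) hw0 hw0; rewrite scale1r eqxx mcoeff1 eqxx => -> /eqP.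
  by rewrite oner_eq0.
case: t tA => [t|t] tA.
  apply: Phi_linear_relation (l1 t); first exact: line_pred_killer.
  exact: line_pred_exclusive hw0.
rewrite /= Phi_quadratic_rel ?enum_valP // ifN //.
by apply: contra t0A => /eqP/enum_val_inj ->.
Qed.

Theorem theorem1p2 (k : fieldType) (n : nat) (hn : (1 <= n)%N) :
  (2%N \notin [pchar k] ->
     minimally_generates (@det_quadric k n) (apolar (det_poly k n)) /\
     exists r : 'I_(4 * 'C(n.+1, 3) * 'C(n.+2, 3)) -> F1 k n,
       (forall t, linear_relation (@det_quadric k n) (r t)) /\
       minimally_generates r (relation (@det_quadric k n)))
  /\
  (minimally_generates (@perm_quadric k n) (apolar (perm_poly k n)) /\
   exists r : 'I_(4 * 'C(n.+1, 3) * 'C(n.+2, 3)) + 'I_(2 * 'C(n, 2) * 'C(n, 4))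
              -> F1 k n,
     (forall t, linear_relation (@perm_quadric k n) (r (inl t))) /\
     (forall t, quadratic_relation (@perm_quadric k n) (r (inr t))) /\
     minimally_generates r (relation (@perm_quadric k n))).
Proof.
split=> [char2|]; split.
- rewrite det_immanant; apply: quadrics_generate; exact: mulr1.
- exact: det_relations.
- rewrite perm_immanant; apply: quadrics_generate; by rewrite mulrNN mulr1.
- exact: perm_relations.
Qed.
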